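(* Let $A := \{ (8k-3)(8l-3) \mid k, l \in \mathbb{Z},\ k \equiv l \pmod 2 \}$, which satisfies $A \subsetneq \{ 16m - 7 \mid m \in \mathbb{Z} \}$. Then \begin{align*} S({\rm C}_{8} \times {\rm C}_{2}) &= \left\{ 16m+1,\ m',\ 2^{10}(2m+1),\ 2^{12} m \mid m \in \mathbb{Z},\ m' \in A \right\} \\ &\quad \cup \left\{ 2^{11} p (2m+1) \mid p = a^{2} + b^{2} \equiv 1 \ ({\rm mod}\ 8),\ a + b \equiv \pm 3 \ ({\rm mod}\ 8),\ a, b, m \in \mathbb{Z} \right\} \\ &\quad \cup \left\{ 2^{11} p (2m+1) \mid p \equiv -3 \ ({\rm mod}\ 8),\ m \in \mathbb{Z} \right\} \\ &\quad \cup \left\{ 2^{11} p^{2} (2m+1) \mid p \equiv 3 \ ({\rm mod}\ 8),\ m \in \mathbb{Z} \right\}, \end{align*} where $p$ denotes a prime.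
   Context: ${\rm C}_n$ denotes the cyclic group of order $n$. For a finite group $G$ and integers $x_g$ ($g \in G$), let $\Theta_G(x_g) := \det\left( x_{gh^{-1}} \right)_{g,h \in G}$ be the group determinant. Define $S(G) := \{ \Theta_G(x_g) \mid x_g \in \mathbb{Z} \text{ for all } g \in G \} \subset \mathbb{Z}$. Primes are positive. *)

(* Defs.v *)
From mathcomp Require Import all_boot all_order all_algebra all_fingroup.
From mathcomp Require Import classical_sets.

Set Implicit Arguments.
Unset Strict Implicit.
Unset Printing Implicit Defensive.

Import GRing.Theory Num.Theory.
Local Open Scope classical_set_scope.
Local Open Scope ring_scope.

(* Rows and columns are indexed by ordinals through the enumeration of the
   group; using the same enumeration for both makes the determinant
   independent of its choice. *)
Definition group_det (gT : finGroupType) (x : gT -> int) : int :=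
  \det (\matrix_(i < #|gT|, j < #|gT|) x (enum_val i * (enum_val j)^-1)%g).

Definition group_dets (gT : finGroupType) : set int :=
  [set group_det x | x in [set: gT -> int]].

(* The group law of 'Z_n is addition, and that of a product is componentwise. *)
Definition C8xC2 : finGroupType := ('Z_8 * 'Z_2)%type.

Definition setA : set int :=
  [set n | exists k l : int,
     (k = l %[mod 2])%Z /\ n = (8 * k - 3) * (8 * l - 3)].

(* Main.v *)
Require Import Defs.
From mathcomp Require Import all_boot all_order all_algebra all_fingroup.
From mathcomp Require Import classical_sets.
From mathcomp Require Import all_solvable all_field zify ring.

(** A function on C8 x C2 amounts to two vectors x, y of eight integers. The
characters of the group factor its determinant as det8 (x + y) * det8 (x - y)
(group_det_C8xC2), where, for F the polynomial with coefficients c and z a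
primitive 8th root of unity,
  det8 c = F(1) F(-1) |F(i)|^2 N(F(z)),
and N(F(z)) = |w|^2 for w the norm of F(z) to the Gaussian integers. The two
vectors are arbitrary but congruent modulo 2, and the whole theorem is about
what this congruence forces on the two values of det8.

Odd determinants (odd_group_det). Modulo 8 an odd det8 c depends only on c
modulo 2, so the product is 1 modulo 8. If F(1), F(-1) and |F(i)|^2 are 1 or -1
modulo 8, this persists modulo 16 and the product is 1 modulo 16. Otherwise the
product has a divisor that is 3 or -3 modulo 8, and the elements of setA are
exactly the integers with such a divisor that are 9 modulo 16.

Even determinants (even_group_det). Either 64 divides both factors, or each
factor is 32 u v with v odd and 8 u = F(1) F(-1). So 2^10 divides the product,
and 2^11 is the exact power of 2 only if one u is odd and the other is 2 modulo
4. But if the real and imaginary parts of F(i) and the real part of w are 1 or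
-1 modulo 8, then the parity of u depends only on c modulo 2 (sum_alt_corr4).
Hence one of these numbers is 3 or -3 modulo 8; dividing F(i) or w by 1 + i
gives a Gaussian integer a + b i with a + b = 3 or -3 modulo 8 whose norm
divides the product. If no prime factor of this norm is 5 modulo 8, then all
Gaussian prime factors have b = 0 modulo 4 up to units. On such Gaussian
integers the class of a + b modulo 8 up to sign is multiplicative, so one prime
factor already has the property. In both cases the norm of the prime factor is
one of the three kinds of numbers in the theorem (exceptional_divisor).

Realization. All values come from explicit pairs of vectors. The constant
vector affects F(1) only, which produces the free parameter m. For 2^11 p with
p = 5 modulo 8 the Gaussian integer of norm 2 p is taken as F(i). In the two
other cases the exceptional number is the norm of F(z) / (1 + z)
(norm8_in_dets). The square of a prime p = 3 modulo 8 is a norm because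
p = x^2 + 2 y^2; a prime p = 1 modulo 8 is a norm by a pigeonhole argument in
the ring of integers of the 8th cyclotomic field (prime_is_norm8), and the
condition on a + b passes to the relative norm w because p is a sum of two
squares in one way only. *)

Set Implicit Arguments.
Unset Strict Implicit.
Unset Printing Implicit Defensive.

Import Order.TTheory GRing.Theory Num.Theory.
Local Open Scope ring_scope.

(** * The determinant as a product over characters *)

(** If each [psi i] is multiplicative, the matrix of the [psi i] intertwines the
group matrix with a diagonal one; its determinant cancels on both sides. *)
Lemma group_det_diag (gT : finGroupType) (F : comNzRingType) (psi : gT -> gT -> F)
    (x : gT -> int) :
  (forall i g h, psi i (g * h)%g = psi i g * psi i h) ->
  GRing.lreg (\det (\matrix_(i < #|gT|, j < #|gT|)
     psi (enum_val i) (enum_val j))) ->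
  (group_det x)%:~R = \prod_i \sum_u (x u)%:~R * psi i u.
Proof.
move=> psiM; set X := \matrix_(i, j) _ => regX.
pose lam i := \sum_u (x u)%:~R * psi i u.
pose M : 'M[F]_#|gT| := map_mx intr
  (\matrix_(i < #|gT|, j < #|gT|) x (enum_val i * (enum_val j)^-1)%g).
have bij_ev : {on [pred i | true], bijective (@enum_val gT predT)}.
  exact/onW_bij/enum_val_bij.
have eqXM : X *m M = diag_mx (\row_i lam (enum_val i)) *m X.
  apply/matrixP=> i j; rewrite mul_diag_mx !mxE big_distrl /=.
  pose h := enum_val j; rewrite (reindex_inj (mulIg h^-1)%g) /=.
  rewrite (reindex _ bij_ev) /=; apply: eq_bigr => k _; rewrite !mxE.
  by rewrite mulrC -mulrA -psiM mulgKV.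
have /esym := congr1 determinant eqXM.
rewrite !det_mulmx det_diag mulrC det_map_mx => /regX <-.
by rewrite [RHS](reindex _ bij_ev) /=; apply: eq_bigr => i _; rewrite mxE.
Qed.

(** In what follows [c] lists the coefficients of a polynomial F of degree less
than 8: [sum8], [alt8] and [gre c + i gim c] are its values at 1, -1 and i. *)
Definition sum8 (R : comNzRingType) (c : nat -> R) : R :=
  c 0%N + c 1%N + c 2%N + c 3%N + c 4%N + c 5%N + c 6%N + c 7%N.

Definition alt8 (R : comNzRingType) (c : nat -> R) : R :=
  c 0%N - c 1%N + c 2%N - c 3%N + c 4%N - c 5%N + c 6%N - c 7%N.

Definition gre (R : comNzRingType) (c : nat -> R) : R :=
  c 0%N - c 2%N + c 4%N - c 6%N.

Definition gim (R : comNzRingType) (c : nat -> R) : R :=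
  c 1%N - c 3%N + c 5%N - c 7%N.

(** For h = d0 + d1 z + d2 z^2 + d3 z^3 with z^4 = -1, the product of h with its
image under z -> -z is [relre - z^2 relim], so that [norm8] is the norm of h
from the 8th cyclotomic field to the rationals. *)
Definition relre (R : comNzRingType) (d0 d1 d2 d3 : R) : R :=
  d0 ^+ 2 - d2 ^+ 2 + 2 * d1 * d3.

Definition relim (R : comNzRingType) (d0 d1 d2 d3 : R) : R :=
  d1 ^+ 2 - d3 ^+ 2 - 2 * d0 * d2.

Definition norm8 (R : comNzRingType) (d0 d1 d2 d3 : R) : R :=
  relre d0 d1 d2 d3 ^+ 2 + relim d0 d1 d2 d3 ^+ 2.

Definition det8 (R : comNzRingType) (c : nat -> R) :=
  sum8 c * alt8 c * (gre c ^+ 2 + gim c ^+ 2)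
  * norm8 (c 0%N - c 4%N) (c 1%N - c 5%N) (c 2%N - c 6%N) (c 3%N - c 7%N).

(** The coefficients of F(z) in the basis 1, z, z^2, z^3 are the differences
[c i - c (i + 4)]. *)
Definition Fz_re (R : comNzRingType) (c : nat -> R) :=
  relre (c 0%N - c 4%N) (c 1%N - c 5%N) (c 2%N - c 6%N) (c 3%N - c 7%N).

Definition Fz_im (R : comNzRingType) (c : nat -> R) :=
  relim (c 0%N - c 4%N) (c 1%N - c 5%N) (c 2%N - c 6%N) (c 3%N - c 7%N).

Ltac unfold_det8 :=
  rewrite /Fz_re /Fz_im /det8 /norm8 /relre /relim /sum8 /alt8 /gre /gim.

Lemma det8E (R : comNzRingType) (c : nat -> R) :
  det8 c = sum8 c * alt8 c * (gre c ^+ 2 + gim c ^+ 2)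
  * (Fz_re c ^+ 2 + Fz_im c ^+ 2).
Proof. by []. Qed.

Lemma eq_det8 (c c' : nat -> int) :
  (forall i, (i < 8)%N -> c i = c' i) -> det8 c = det8 c'.
Proof. by move=> eq_c; unfold_det8; rewrite !eq_c. Qed.

Lemma det8_morph (R S : comNzRingType) (f : {rmorphism R -> S}) (c : nat -> R) :
  det8 (f \o c) = f (det8 c).
Proof.
by rewrite /det8 /norm8 /relre /relim /sum8 /alt8 /gre /gim /=
  !(rmorphM, rmorphD, rmorphB, rmorphXn, rmorph_nat, rmorphN, rmorph1).
Qed.

(** The factors for j = 0 and j = 4 are F(1) and F(-1), those for j = 2 and j = 6
multiply to |F(i)|^2, and the odd j give the four conjugates of F(z). The proof
adds to the right-hand side a multiple of z^4 + 1 that turns each equation into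
a polynomial identity. *)
Lemma prod_det8 (R : comNzRingType) (z : R) (c : nat -> R) : z ^+ 4 = -1 ->
  \prod_(j < 8) \sum_(a < 8) c a * z ^+ (j * a) = det8 c.
Proof.
move=> z4.
have red k : z ^+ k.+4 = - z ^+ k by rewrite -addn4 exprD z4 mulrN1.
rewrite !big_ord_recr !big_ord0 /= !add0r !mul1r.
rewrite !(mul0n, mul1n, muln0, muln1) !mulnE /=.
rewrite !red.
have zz0 : z ^+ 4 + 1 = 0 by rewrite z4 addNr.
rewrite /det8 /norm8; set d0 := c 0%N - _; set d1 := c 1%N - _.
set d2 := c 2%N - _; set d3 := c 3%N - _.
have f2 : (gre c + gim c * z ^+ 2) * (gre c - gim c * z ^+ 2)
        = gre c ^+ 2 + gim c ^+ 2.
  rewrite -[RHS]addr0 -[0](mulr0 (- gim c ^+ 2)) -zz0; ring.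
have f15 : (d0 + d1 * z + d2 * z ^+ 2 + d3 * z ^+ 3)
         * (d0 - d1 * z + d2 * z ^+ 2 - d3 * z ^+ 3)
         = relre d0 d1 d2 d3 - z ^+ 2 * relim d0 d1 d2 d3.
  rewrite -[RHS]addr0 -[0](mulr0 (d2 ^+ 2 - 2 * d1 * d3 - d3 ^+ 2 * z ^+ 2)).
  by rewrite -zz0 /relre /relim; ring.
have f37 : (d0 + d1 * z ^+ 3 - d2 * z ^+ 2 + d3 * z)
         * (d0 - d1 * z ^+ 3 - d2 * z ^+ 2 - d3 * z)
         = relre d0 d1 d2 d3 + z ^+ 2 * relim d0 d1 d2 d3.
  rewrite -[RHS]addr0 -[0](mulr0 (d2 ^+ 2 - 2 * d1 * d3 - d1 ^+ 2 * z ^+ 2)).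
  by rewrite -zz0 /relre /relim; ring.
have f1357 : (relre d0 d1 d2 d3 - z ^+ 2 * relim d0 d1 d2 d3)
           * (relre d0 d1 d2 d3 + z ^+ 2 * relim d0 d1 d2 d3)
           = relre d0 d1 d2 d3 ^+ 2 + relim d0 d1 d2 d3 ^+ 2.
  rewrite -[RHS]addr0 -[0](mulr0 (- relim d0 d1 d2 d3 ^+ 2)) -zz0; ring.
rewrite -f2 -f1357 -f15 -f37 /sum8 /alt8 /gre /gim /d0 /d1 /d2 /d3 expr0 expr1.
ring.
Qed.

Definition chi (z : algC) (i u : C8xC2) : algC :=
  z ^+ (i.1 * u.1) * (-1) ^+ (i.2 * u.2).

Lemma chiM (z : algC) i g h : z ^+ 4 = -1 ->
  chi z i (g * h)%g = chi z i g * chi z i h.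
Proof.
move=> z4; have z8 : z ^+ 8 = 1 by rewrite (exprM z 4 2) z4 expr2 mulrNN mulr1.
have z8i : (z ^+ i.1) ^+ 8 = 1 by rewrite exprAC z8 expr1n.
have s2i : ((-1 : algC) ^+ i.2) ^+ 2 = 1 by rewrite exprAC sqrrN !expr1n.
rewrite /chi !exprM mulrACA -!exprD.
congr (_ * _).
  by rewrite -[RHS](expr_mod _ z8i).
by rewrite -[RHS](expr_mod _ s2i).
Qed.

(** Column orthogonality. It inverts the character table up to the factor 16. *)
Lemma sum_chi (z : algC) u : z ^+ 4 = -1 ->
  \sum_i chi z i u = 16 *+ (u == 1%g).
Proof.
move=> z4.
have z4k k : z ^+ k.+4 = - z ^+ k by rewrite -addn4 exprD z4 mulrN1.
case: u => k l; rewrite /chi /=.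
rewrite -(pair_bigA _ (fun (a : 'I_8) (b : 'I_2) =>
  z ^+ (a * k) * (-1) ^+ (b * l))) /=.
rewrite -[(_, _) == _]/((k == 0) && (l == 0)).
rewrite !big_ord_recr !big_ord0 /=.
case: k => -[|[|[|[|[|[|[|[|//]]]]]]]] ?; case: l => -[|[|//]] ?;
  rewrite /= ?mulnE /= ?z4k ?expr0 ?expr1 /= ?mulr0n ?mulr1n; ring.
Qed.

Lemma det_chi_neq0 (z : algC) : z ^+ 4 = -1 ->
  \det (\matrix_(i < #|C8xC2|, j < #|C8xC2|)
     chi z (enum_val i) (enum_val j)) != 0.
Proof.
move=> z4.
set X := \matrix_(i, j) _.
pose Y : 'M[algC]_#|C8xC2| :=
  \matrix_(i, j) chi z (enum_val j) (enum_val i)^-1%g.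
suff eqYX : Y *m X = 16%:M.
  have := congr1 determinant eqYX; rewrite det_mulmx det_scalar => eqd.
  apply/eqP=> X0; move/eqP: eqd; rewrite X0 mulr0 eq_sym expf_eq0.
  by rewrite pnatr_eq0 andbF.
apply/matrixP=> i j; rewrite !mxE.
transitivity (\sum_i0 chi z i0 ((enum_val i)^-1 * enum_val j)%g).
  rewrite [RHS](reindex _ (onW_bij _ (enum_val_bij _))) /=.
  by apply: eq_bigr => k _; rewrite !mxE -chiM.
by rewrite (sum_chi _ z4) -eq_mulVg1 (inj_eq enum_val_inj).
Qed.

Lemma group_det_C8xC2 (x : C8xC2 -> int) :
  let c b i : int := x (inord i, b) in
  group_det x = det8 (fun i => c 0 i + c 1 i) * det8 (fun i => c 0 i - c 1 i).
Proof.
move=> c; have [z prim_z] := C_prim_root_exists (isT : (0 < 8)%N).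
have z4 : z ^+ 4 = -1.
  apply/eqP; have /eqP := prim_expr_order prim_z.
  rewrite (exprM z 4 2) sqrf_eq1 -(prim_order_dvd prim_z) /=.
  by [].
have eval i : \sum_u (x u)%:~R * chi z i u =
    \sum_(a < 8) (c 0 a + (-1) ^+ i.2 * c 1 a)%:~R * z ^+ (i.1 * a).
  pose G (a : 'Z_8) (b : 'Z_2) : algC := (x (a, b))%:~R * chi z i (a, b).
  transitivity (\sum_(a : 'Z_8) \sum_(b : 'Z_2) G a b).
    by rewrite pair_bigA; apply: eq_bigr => -[].
  apply: eq_bigr => a _; rewrite !big_ord_recr big_ord0 /= add0r /G /chi /=.
  rewrite /c inord_val.
  rewrite muln0 muln1 expr0 mulr1 rmorphD rmorphM rmorphXn rmorphN1 /=.
  rewrite mulrDl; congr (_ * _ + _).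
    by congr (x (_, _))%:~R; apply/val_inj.
  rewrite mulrA mulrAC; congr (_ * _); rewrite mulrC; congr (_ * (x (_, _))%:~R).
  exact/val_inj.
(* The characters of C2 separate the two vectors, those of C8 give det8. *)
apply: (@intr_inj algC).
rewrite (group_det_diag _ (fun i g h => chiM i g h z4) (mulfI (det_chi_neq0 z4))).
rewrite (eq_bigr _ (fun i _ => eval i)).
pose G (a : 'I_8) (b : 'I_2) : algC :=
  \sum_(k < 8) (c 0 k + (-1) ^+ b * c 1 k)%:~R * z ^+ (a * k).
transitivity (\prod_(a : 'I_8) \prod_(b : 'I_2) G a b).
  by rewrite pair_bigA.
under eq_bigr => a _ do rewrite !big_ord_recr big_ord0 /= mul1r.
rewrite big_split rmorphM -!(det8_morph intr) -!(prod_det8 _ z4).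
congr (_ * _); apply: eq_bigr => a _; apply: eq_bigr => k _ /=.
  by rewrite expr0 mul1r.
by rewrite expr1 mulN1r.
Qed.

(** * Primes and binary quadratic forms *)

Lemma parity (x : int) : exists x', x = 2 * x' \/ x = 2 * x' + 1.
Proof. by exists (x %/ 2)%Z; lia. Qed.

Lemma pronic_even (x : int) : exists t, x * x + x = 2 * t.
Proof.
have [y [->|->]] := parity x; last by exists ((2 * y + 1) * (y + 1)); ring.
by exists (y * (2 * y + 1)); ring.
Qed.

Lemma odd_square (n : int) : exists t, (2 * n + 1) ^+ 2 = 8 * t + 1.
Proof. have [t def_t] := pronic_even n; exists t; lia. Qed.

Lemma sqrt2_irrational (x y : int) : x ^+ 2 = 2 * y ^+ 2 -> x = 0 /\ y = 0.
Proof.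
have [->|nz_y] := eqVneq y 0.
  by rewrite expr0n mulr0 => /eqP; rewrite sqrf_eq0 => /eqP.
move=> /(congr1 (fun a : int => logn 2 `|a|)); rewrite abszM !abszX.
rewrite lognM ?expn_gt0 ?absz_gt0 ?nz_y // !lognX.
by rewrite (_ : logn 2 `|2| = 1%N) //; lia.
Qed.

Lemma Euclid_dvdzM p (x y : int) : prime p ->
  (p %| x * y)%Z = (p %| x)%Z || (p %| y)%Z.
Proof. by move=> p_pr; rewrite !dvdzE abszM Euclid_dvdM. Qed.

(** Thue's argument: there are more vectors with entries in [0, k] than residues
modulo [m], so two of them give the same value of the linear form. *)
Lemma thue_pigeonhole n k m (v : 'I_n -> int) : (0 < m < k.+1 ^ n)%N ->
  exists d : 'I_n -> int, [/\ exists i, d i != 0, forall i, (`|d i| <= k)%N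
    & (m %| \sum_i v i * d i)%Z].
Proof.
case: m => // m /= ltm.
pose val_of (f : {ffun 'I_n -> 'I_k.+1}) : int := \sum_i v i * (f i : nat)%:Z.
pose res f : 'I_m.+1 := inord `|(val_of f %% m.+1)%Z|.
have /injectivePn[f [g neq_fg eq_res]] : ~~ injectiveb res.
  apply/negP=> /injectiveP/leq_card; rewrite card_ffun !card_ord leqNgt.
  by rewrite ltm.
exists (fun i => (f i : nat)%:Z - (g i : nat)%:Z); split.
- apply/existsP; apply: contraR neq_fg => /existsPn eq_fg.
  apply/eqP/ffunP=> i; apply: val_inj.
  by move/negPn: (eq_fg i); rewrite subr_eq0 => /eqP[].
- by move=> i; have := ltn_ord (f i); have := ltn_ord (g i); lia.
- have -> : \sum_i v i * ((f i : nat)%:Z - (g i : nat)%:Z) = val_of f - val_of g.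
    by rewrite /val_of -sumrB; apply: eq_bigr => i _; rewrite mulrBr.
  rewrite -eqz_mod_dvd; apply/eqP.
  have lt_mod h : (`|(val_of h %% m.+1)%Z| < m.+1)%N by lia.
  have := congr1 (fun i : 'I_m.+1 => (i : nat)%:Z) eq_res.
  by rewrite !inordK // !gez0_abs ?modz_ge0.
Qed.

(** A prime is not a perfect power, so the bounds can be taken strict on both
sides, as the pigeonhole argument requires. *)
Lemma prime_root_bounds n p : prime p -> (1 < n)%N ->
  exists k, (k ^ n < p < k.+1 ^ n)%N.
Proof.
move=> p_pr n_gt1; have n_gt0 := ltnW n_gt1.
have exP : exists k, (k ^ n < p)%N.
  exists 0%N; rewrite exp0n; last exact: n_gt0.
  exact: prime_gt0.
have ubP k : (k ^ n < p)%N -> (k <= p)%N.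
  move=> ltkp; apply: leq_trans (ltnW ltkp).
  by case: k ltkp => // k _; rewrite -{1}(expn1 k.+1) leq_pexp2l.
case: (ex_maxnP exP ubP) => k ltkp maxk; exists k; rewrite ltkp /=.
rewrite ltn_neqAle leqNgt; apply/andP; split; last first.
  by apply/negP => /maxk; rewrite ltnn.
apply/eqP=> p_def; have := congr1 (logn p) p_def.
rewrite lognX logn_prime // eqxx => /esym/eqP; rewrite muln_eq1 => /andP[/eqP n1 _].
by rewrite n1 in n_gt1.
Qed.

Lemma thue_pair p (r : int) : prime p -> exists x y : int,
  [/\ (x != 0) || (y != 0), x ^+ 2 < p%:Z, y ^+ 2 < p%:Z & (p %| x + r * y)%Z].
Proof.
move=> p_pr; have [k /andP[ltkp ltpk]] := prime_root_bounds p_pr (isT : (1 < 2)%N).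
have [|d [[i nz_i] led dvd]] := @thue_pigeonhole 2 k p
   (fun i => r ^+ i); first by rewrite prime_gt0.
exists (d ord0), (d ord_max).
have d2 j : d j ^+ 2 < p%:Z by have := led j; nia.
split=> //.
  have [i0|i1] : i = ord0 \/ i = ord_max.
    by case: i {nz_i} => -[|[|//]] ?; [left|right]; apply: val_inj.
  - by rewrite -i0 nz_i.
  - by rewrite -i1 nz_i orbT.
move: dvd; rewrite !big_ord_recr big_ord0 /= add0r mul1r expr1.
by rewrite (_ : widen_ord _ _ = ord0) //; apply: val_inj.
Qed.

Lemma dvdz_Fp p (a : int) : prime p -> (p %| a)%Z = (a%:~R == 0 :> 'F_p).
Proof. by move/pchar_Fp/dvdz_pcharf. Qed.

Lemma Fp_lift p (w : 'F_p) : exists r : int, r%:~R = w.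
Proof. by exists (w : nat)%:Z; rewrite -pmulrn natr_Zp. Qed.

Lemma Fp_expf p (w : 'F_p) : prime p -> w != 0 -> w ^+ p.-1 = 1.
Proof.
move=> p_pr nz_w; apply: (mulfI nz_w); rewrite -exprS prednK ?prime_gt0 //.
by have := expf_card w; rewrite card_Fp // mulr1.
Qed.

(** A power of a primitive root modulo [p] has order [2 n], and its [n]-th power
is then -1. *)
Lemma root_Xn_add1 p n : prime p -> (0 < n)%N -> (n.*2 %| p.-1)%N ->
  exists r : int, (p %| r ^+ n + 1)%Z.
Proof.
move=> p_pr n_gt0 dvd_n.
pose rs := enum [pred w : 'F_p | w != 0].
have p1_gt0 : (0 < p.-1)%N by rewrite -subn1 subn_gt0 prime_gt1.
have /hasP[z _ prim_z] : has p.-1.-primitive_root rs.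
  apply: has_prim_root => //; last 2 first.
  - exact: enum_uniq.
  - by rewrite -cardE cardC1 card_Fp.
  apply/allP=> w; rewrite mem_enum inE => nz_w; apply/unity_rootP.
  exact: Fp_expf.
have prim_w := dvdn_prim_root prim_z dvd_n.
set w := z ^+ _ in prim_w; have [r def_r] := Fp_lift w.
exists r; rewrite dvdz_Fp // rmorphD rmorphXn rmorph1 /= def_r addr_eq0.
have /eqP := prim_expr_order prim_w.
rewrite -muln2 exprM sqrf_eq1 -(prim_order_dvd prim_w) gtnNdvd //.
by rewrite -addnn -[ltnLHS]addn0 ltn_add2l.
Qed.

(** Raising a^2 = - b^2 to the odd power (p - 1) / 2 would give 1 = -1 in the field
with [p] elements. *)
Lemma inert_dvd p (a b : int) : prime p -> (p %% 4 = 3)%N ->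
  (p %| a ^+ 2 + b ^+ 2)%Z -> (p %| a)%Z /\ (p %| b)%Z.
Proof.
move=> p_pr p3.
have inert_l (u v : int) : (p %| u ^+ 2 + v ^+ 2)%Z -> (p %| u)%Z.
  rewrite !dvdz_Fp // rmorphD !rmorphXn /= addr_eq0 => /eqP uv.
  apply/eqP/eqP; apply: contraTT (isT) => nz_u.
  have nz_v : (v%:~R : 'F_p) != 0.
    apply: contraNneq nz_u => v0; rewrite v0 expr0n oppr0 in uv.
    by rewrite -sqrf_eq0 uv.
  have := congr1 (fun w => w ^+ (p.-1)./2) uv.
  rewrite /= exprNn -!exprM !mul2n.
  have -> : ((p.-1)./2.*2 = p.-1)%N by lia.
  rewrite !Fp_expf // mulr1 -signr_odd.
  have -> : odd (p.-1)./2 by lia.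
  rewrite expr1 => /eqP; rewrite -addr_eq0 -[_ + _]/(2%:R).
  rewrite -(dvdn_pcharf (pchar_Fp p_pr)).
  by rewrite dvdn_prime2 // => /eqP p2; rewrite p2 in p3.
by move=> dvd_ab; split; [apply: inert_l dvd_ab | apply: (inert_l b a); rewrite addrC].
Qed.

(** By Fermat 2^((p - 1) / 2) is 1 or -1, and (p - 1) / 2 is odd, so that
2^((p + 1) / 4) is a square root of 2 or of -2. *)
Lemma sqrtN2_or_sqrt2 p : prime p -> (p %% 4 = 3)%N ->
  exists r : int, (p %| r ^+ 2 + 2)%Z \/ (p %| r ^+ 2 - 2)%Z.
Proof.
move=> p_pr p3; pose k := (p %/ 4).+1.
have nz2 : (2 : 'F_p) != 0.
  rewrite -(dvdn_pcharf (pchar_Fp p_pr)) dvdn_prime2 //.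
  by apply: contraPneq p3 => ->.
have := Fp_expf p_pr nz2; have -> : p.-1 = ((p %/ 4).*2.+1 * 2)%N by lia.
rewrite exprM => /eqP; rewrite sqrf_eq1 => /orP[] /eqP two1.
  have [r def_r] := Fp_lift ((2 : 'F_p) ^+ k); exists r; right.
  rewrite dvdz_Fp // rmorphB rmorphXn /= def_r -exprM muln2 doubleS exprS two1.
  by rewrite mulr1 subrr.
have [r def_r] := Fp_lift ((2 : 'F_p) ^+ k); exists r; left.
rewrite dvdz_Fp // rmorphD rmorphXn /= def_r -exprM muln2 doubleS exprS two1.
by rewrite mulrN1 addNr.
Qed.

Lemma dvdz_between p (n : int) (lo hi : int) : (0 < p)%N -> (p %| n)%Z ->
  lo * p%:Z < n < hi * p%:Z -> exists2 q, n = q * p%:Z & lo < q < hi.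
Proof.
move=> p_gt0 /dvdzP[q ->]; rewrite !ltr_pM2r ?ltz_nat // => ?; by exists q.
Qed.

Lemma dvd_form2 p (r x y c : int) : (p %| r ^+ 2 + c)%Z -> (p %| x + r * y)%Z ->
  (p %| x ^+ 2 + c * y ^+ 2)%Z.
Proof.
move=> dvd_r dvd_xy.
have -> : x ^+ 2 + c * y ^+ 2 = (x + r * y) * (x - r * y) + (r ^+ 2 + c) * y ^+ 2.
  ring.
by apply: rpredD; apply: dvdz_mulr.
Qed.

Lemma sum_sqr_gt0 (x y : int) : (x != 0) || (y != 0) -> 0 < x ^+ 2 + y ^+ 2.
Proof.
move=> nz; rewrite lt0r paddr_eq0 ?sqr_ge0 // !sqrf_eq0 negb_and nz.
by rewrite addr_ge0 ?sqr_ge0.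
Qed.

Lemma two_squares p : prime p -> (p %% 4 = 1)%N ->
  exists a b : int, p%:Z = a ^+ 2 + b ^+ 2.
Proof.
move=> p_pr p1; have p_gt0 := prime_gt0 p_pr.
have [|r dvd_r] := root_Xn_add1 p_pr (isT : (0 < 2)%N).
  by apply/dvdnP; exists (p %/ 4)%N; lia.
have [x [y [nz x2 y2 dvd_xy]]] := thue_pair r p_pr.
have pos := sum_sqr_gt0 nz; have := sqr_ge0 x; have := sqr_ge0 y => y0 x0.
have [|q def_q qlt] := dvdz_between p_gt0 (dvd_form2 dvd_r dvd_xy) (lo := 0) (hi := 2).
  lia.
by exists x, y; rewrite mul1r in def_q; rewrite def_q (_ : q = 1) ?mul1r //; lia.
Qed.

(** If -2 is a square modulo [p], Thue's argument gives x^2 + 2 y^2 = p or 2 p, and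
the second case reduces to the first. If 2 were a square it would give
x^2 - 2 y^2 = - p, which is impossible modulo 8. This decides which of the two
is a square without quadratic reciprocity. *)
Lemma square_plus_two_squares p : prime p -> (p %% 8 = 3)%N ->
  exists x y : int, p%:Z = x ^+ 2 + 2 * y ^+ 2.
Proof.
move=> p_pr p3; have p_gt0 := prime_gt0 p_pr.
have [|r] := sqrtN2_or_sqrt2 p_pr; first lia.
have [x [y [nz x2 y2 dvd_xy]]] := thue_pair r p_pr.
have pos := sum_sqr_gt0 nz; have := sqr_ge0 x; have := sqr_ge0 y => y0 x0.
case=> /dvd_form2-/(_ _ _ dvd_xy) dvd_f.
  have [|q def_q qlt] := dvdz_between p_gt0 dvd_f (lo := 0) (hi := 3); first lia.
  have [q1|q2] : q = 1 \/ q = 2 by lia.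
    by exists x, y; rewrite def_q q1 mul1r.
  have [x' [def_x|def_x]] := parity x; last by subst x; lia.
  by exists y, x'; move: def_q; rewrite q2 def_x; clear; lia.
have [|q def_q qlt] := dvdz_between p_gt0 dvd_f (lo := -2) (hi := 1); first lia.
have [q1|q0] : q = -1 \/ q = 0 by lia.
  have [x' [x_even|x_odd]] := parity x; first by subst x; lia.
  have [t def_t] := pronic_even x'.
  move: def_q p3; rewrite q1 x_odd; clear - def_t.
  have [y' [->|->]] := parity y; first lia.
  have [w def_w] := pronic_even y'; lia.
have [|x00 y00] := @sqrt2_irrational x y; first lia.
by rewrite x00 y00 eqxx in nz.
Qed.

(** [p] divides (a c - b d)(a c + b d). As (a c - b d)^2 + (a d + b c)^2 = p^2, the
divisible factor is 0 or p up to sign, and each case determines c^2. *)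
Lemma two_squares_unique p (a b c d : int) : prime p ->
  p%:Z = a ^+ 2 + b ^+ 2 -> p%:Z = c ^+ 2 + d ^+ 2 ->
  c ^+ 2 = a ^+ 2 \/ c ^+ 2 = b ^+ 2.
Proof.
move=> p_pr def_p def_p'.
have nz_p : p%:Z != 0 by rewrite eqz_nat -lt0n prime_gt0.
have dvd_cases (d' : int) : d' ^+ 2 = d ^+ 2 -> (p %| a * c - b * d')%Z ->
    c ^+ 2 = a ^+ 2 \/ c ^+ 2 = b ^+ 2.
  move=> def_d' /dvdzP[q def_q]; rewrite -def_d' in def_p'.
  have norm : (q * p%:Z) ^+ 2 + (a * d' + b * c) ^+ 2 = p%:Z * p%:Z.
    by rewrite -def_q {1}def_p def_p'; ring.
  have [q0|nz_q] := eqVneq q 0.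
    right; apply: (mulfI nz_p).
    move/eqP: def_q; rewrite q0 mul0r subr_eq0 => /eqP def_q.
    transitivity ((a * c) ^+ 2 + b ^+ 2 * c ^+ 2); first by rewrite def_p; ring.
    by rewrite def_q def_p'; ring.
  left; apply: (mulfI nz_p).
  have adbc : a * d' + b * c = 0.
    apply/eqP; rewrite -sqrf_eq0 eq_le sqr_ge0 andbT.
    have -> : (a * d' + b * c) ^+ 2 = p%:Z * p%:Z * (1 - q ^+ 2).
      by rewrite mulrBr mulr1 -[X in _ = X - _]norm; ring.
    rewrite mulr_ge0_le0 ?mulr_ge0 // subr_le0.
    by have := sqr_ge0 q; rewrite le_eqVlt eq_sym sqrf_eq0 (negbTE nz_q).
  move/eqP: adbc; rewrite addr_eq0 => /eqP adbc.
  transitivity (c ^+ 2 * a ^+ 2 + (- (b * c)) ^+ 2); first by rewrite def_p; ring.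
  by rewrite -adbc def_p'; ring.
have : (p %| (a * c - b * d) * (a * c - b * - d))%Z.
  have -> : (a * c - b * d) * (a * c - b * - d)
    = p%:Z * a ^+ 2 + p%:Z * c ^+ 2 - p%:Z * p%:Z.
    have eb : b ^+ 2 = p%:Z - a ^+ 2 by rewrite def_p; ring.
    have ed : d ^+ 2 = p%:Z - c ^+ 2 by rewrite def_p'; ring.
    transitivity (a ^+ 2 * c ^+ 2 - b ^+ 2 * d ^+ 2); first by ring.
    by rewrite eb ed; ring.
  by rewrite -mulrDr -mulrBr dvdz_mulr.
by rewrite Euclid_dvdzM // => /orP[]; apply: dvd_cases; rewrite ?sqrrN.
Qed.

(** An even term of a sum of two squares that is 1 modulo 8 has a square divisible
by 8. *)
Lemma dvd4_even_term p (c d : int) : (p %% 8 = 1)%N -> p%:Z = c ^+ 2 + d ^+ 2 ->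
  (exists c', c = 2 * c' + 1) -> (4 %| d)%Z.
Proof.
move=> p1 def_p [c' c_odd]; move: def_p; rewrite {}c_odd.
have [t def_t] := pronic_even c'.
have [d' [->|->]] := parity d; last by lia.
have [d'' [->|->]] := parity d'; last by lia.
by move=> _; apply/dvdzP; exists d''; ring.
Qed.

(** * Norms from the eighth cyclotomic field *)

(** The two equations say that the absolute values of d0 + d2 i and d1 + d3 i agree
and that 2 d0^2 and 2 d2^2 are squares, which the irrationality of the square
root of 2 forbids unless all vanish. *)
Lemma norm8_eq0 (d0 d1 d2 d3 : int) : norm8 d0 d1 d2 d3 = 0 ->
  [/\ d0 = 0, d1 = 0, d2 = 0 & d3 = 0].
Proof.
move/eqP; rewrite paddr_eq0 ?sqr_ge0 // !sqrf_eq0 /relre /relim.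
case/andP=> /eqP re0 /eqP im0.
have eq_sum : d0 ^+ 2 + d2 ^+ 2 = d1 ^+ 2 + d3 ^+ 2.
  have e1 : d0 ^+ 2 - d2 ^+ 2 = - (2 * d1 * d3).
    by apply/eqP; rewrite -addr_eq0 re0.
  have e2 : d1 ^+ 2 - d3 ^+ 2 = 2 * d0 * d2.
    by apply/eqP; rewrite -subr_eq0 im0.
  apply/eqP; rewrite -(@eqrXn2 _ 2) ?addr_ge0 ?sqr_ge0 //; apply/eqP.
  transitivity ((d0 ^+ 2 - d2 ^+ 2) ^+ 2 + (2 * d0 * d2) ^+ 2); first by ring.
  by rewrite e1 -e2; ring.
(* 2 d0^2 = (d0^2 + d2^2) + (d0^2 - d2^2) = (d1 - d3)^2, and similarly for d2. *)
have [d13 d0_0] : d1 - d3 = 0 /\ d0 = 0.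
  by apply: sqrt2_irrational; clear - eq_sum re0; lia.
have [d13' d2_0] : d1 + d3 = 0 /\ d2 = 0.
  by apply: sqrt2_irrational; clear - eq_sum re0; lia.
by split=> //; clear - d13 d13'; lia.
Qed.

(** Reduction modulo the prime 1 + z above 2 is evaluation at z = -1. *)
Lemma norm8_parity (d0 d1 d2 d3 : int) :
  exists n, norm8 d0 d1 d2 d3 = d0 - d1 + d2 - d3 + 2 * n.
Proof.
pose s := d0 - d1 + d2 - d3.
pose X := - d2 ^+ 2 - d3 ^+ 2 + d0 * d1 - 2 * (d0 * d2) + d0 * d3
  + d1 * d2 + d2 * d3.
pose Y := relre d0 d1 d2 d3 * relim d0 d1 d2 d3.
have -> : norm8 d0 d1 d2 d3 = (s ^+ 2 + 2 * X) ^+ 2 - 2 * Y.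
  by rewrite /norm8 /X /Y /s /relre /relim; ring.
rewrite -/s; have [k [->|->]] := parity s.
  exists (8 * k ^+ 4 + 8 * k ^+ 2 * X + 2 * X ^+ 2 - Y - k); ring.
exists (8 * k ^+ 4 + 16 * k ^+ 3 + 12 * k ^+ 2 + 3 * k
  + 2 * X * (4 * k ^+ 2 + 4 * k + 1) + 2 * X ^+ 2 - Y); ring.
Qed.

(** The element is divisible by 1 + z, which has norm 2; the witness is the
quotient. *)
Lemma norm8_even (d0 d1 d2 d3 n : int) : norm8 d0 d1 d2 d3 = 2 * n ->
  exists e0 e1 e2 e3, norm8 e0 e1 e2 e3 = n.
Proof.
move=> def_n; have [m def_m] : exists m, d0 - d1 + d2 - d3 = 2 * m.
  have [k def_k] := norm8_parity d0 d1 d2 d3.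
  by exists (n - k); rewrite def_k in def_n; clear - def_n; lia.
exists (d0 - m), (d1 - d0 + m), (d2 - d1 + d0 - m), (- m).
apply: (@mulfI _ 2) => //; rewrite -def_n.
have -> : d3 = d0 - d1 + d2 - 2 * m by rewrite -def_m; ring.
rewrite /norm8 /relre /relim; ring.
Qed.

(** One of [relre], [relim] is odd and the other is divisible by 4. *)
Lemma norm8_odd (d0 d1 d2 d3 n : int) : norm8 d0 d1 d2 d3 = 2 * n + 1 ->
  exists m, norm8 d0 d1 d2 d3 = 8 * m + 1.
Proof.
have [t2 p2] := pronic_even d2; have [t3 p3] := pronic_even d3.
have [x [def_x|def_x]] := parity (d0 + d2);
  have [y [def_y|def_y]] := parity (d1 + d3);
  have {}def_x : d0 = _ - d2 := canRL (addrK _) def_x;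
  have {}def_y : d1 = _ - d3 := canRL (addrK _) def_y.
- rewrite /norm8 /relre /relim def_x def_y; clear; lia.
- move=> _; pose h := 2 * y * (y + 1) - 2 * y * d3 - d3 - (2 * x - d2) * d2.
  have [t def_t] := odd_square h.
  exists (t + 2 * (x * (x - d2) + (y + 1) * d3 - t3) ^+ 2).
  transitivity ((4 * (x * (x - d2) + (y + 1) * d3) - 2 * (d3 * d3 + d3)) ^+ 2
    + (2 * h + 1) ^+ 2).
    by rewrite /norm8 /relre /relim def_x def_y /h; ring.
  by rewrite def_t p3; ring.
- move=> _; pose h := 2 * x * (x + 1) - 2 * x * d2 - d2 + (2 * y - d3) * d3.
  have [t def_t] := odd_square h.
  exists (t + 2 * (y * (y - d3) - (x + 1) * d2 + t2) ^+ 2).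
  transitivity ((2 * h + 1) ^+ 2
    + (4 * (y * (y - d3) - (x + 1) * d2) + 2 * (d2 * d2 + d2)) ^+ 2).
    by rewrite /norm8 /relre /relim def_x def_y /h; ring.
  by rewrite def_t p2; ring.
- rewrite /norm8 /relre /relim def_x def_y; clear; lia.
Qed.

(** The form has discriminant 5, which is not a square modulo 3. *)
Lemma mod3_anisotropic (u v : int) : (3 %| u ^+ 2 + u * v - v ^+ 2)%Z ->
  (3 %| u)%Z && (3 %| v)%Z.
Proof.
move=> dvd_uv; have [] := @inert_dvd 3 (2 * u + v) v isT erefl.
  have -> : (2 * u + v) ^+ 2 + v ^+ 2
      = 4 * (u ^+ 2 + u * v - v ^+ 2) + 3 * (2 * v ^+ 2) by ring.
  by apply: rpredD; [apply: dvdz_mull | apply: dvdz_mulr].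
by clear; lia.
Qed.

(** Put t = z + z^3, so that t^2 = -2. Over Z[t] the ring has basis 1, z with
z^2 = t z + 1, and the relative norm of U + V z is U^2 + t U V - V^2, written
[al + be t] below with U = u + d3 t and V = v + d2 t. Modulo the primes 1 - t
and 1 + t above 3, t becomes 1 or -1 and this is an anisotropic form over the
field with three elements. So the element is divisible by one of 1 - t and
1 + t, which have norm 9. *)
Lemma norm8_dvd3 (d0 d1 d2 d3 n : int) : norm8 d0 d1 d2 d3 = 3 * n ->
  exists e0 e1 e2 e3, norm8 d0 d1 d2 d3 = 9 * norm8 e0 e1 e2 e3.
Proof.
move=> def_n.
pose u := d0 + d2; pose v := d1 - d3.
pose al := u ^+ 2 - 2 * d3 ^+ 2 - 2 * (u * d2 + d3 * v) - v ^+ 2 + 2 * d2 ^+ 2.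
pose be := 2 * u * d3 + u * v - 2 * d3 * d2 - 2 * v * d2.
have norm_ab : (al - be) * (al + be) = 3 * (n - be ^+ 2).
  transitivity (norm8 d0 d1 d2 d3 - 3 * be ^+ 2); last by rewrite def_n; ring.
  by rewrite /norm8 /relre /relim /al /be /u /v; ring.
have {norm_ab} : (3 %| al - be)%Z || (3 %| al + be)%Z.
  by rewrite -(@Euclid_dvdzM 3) // norm_ab dvdz_mulr.
(* The quotient by 1 - t is the product with 1 + t divided by 3. *)
have scale e0 e1 e2 e3 (c0 c1 c2 c3 : int) :
    [/\ c0 = e0 * 3, c1 = e1 * 3, c2 = e2 * 3 & c3 = e3 * 3] ->
    norm8 c0 c1 c2 c3 = 9 * norm8 d0 d1 d2 d3 ->
    norm8 d0 d1 d2 d3 = 9 * norm8 e0 e1 e2 e3.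
  move=> [-> -> -> ->] def_c; apply: (@mulfI _ 9) => //; rewrite -def_c.
  by rewrite /norm8 /relre /relim; ring.
case/orP=> dvd3.
  have /andP[dvd_u dvd_v] : (3 %| u - d3)%Z && (3 %| - (v - d2))%Z.
    apply: mod3_anisotropic.
    have -> : (u - d3) ^+ 2 + (u - d3) * - (v - d2) - (- (v - d2)) ^+ 2
      = al - be + 3 * (d3 ^+ 2 + u * d2 + d3 * v - d2 ^+ 2 - d3 * d2).
      by rewrite /al /be; ring.
    by apply: rpredD; last apply: dvdz_mulr.
  have : [&& (3 %| d0 + d3 + d1), (3 %| d1 - d0 + d2),
             (3 %| d2 - d1 + d3) & (3 %| d3 - d2 - d0)]%Z.
    by move: dvd_u dvd_v; rewrite /u /v; clear; lia.
  case/and4P=> /dvdzP[e0 E0] /dvdzP[e1 E1] /dvdzP[e2 E2] /dvdzP[e3 E3].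
  exists e0, e1, e2, e3; apply: scale (And4 E0 E1 E2 E3) _.
  by rewrite /norm8 /relre /relim; ring.
have /andP[dvd_u dvd_v] : (3 %| u + d3)%Z && (3 %| v + d2)%Z.
  apply: mod3_anisotropic.
  have -> : (u + d3) ^+ 2 + (u + d3) * (v + d2) - (v + d2) ^+ 2
    = al + be + 3 * (d3 ^+ 2 + u * d2 + d3 * v - d2 ^+ 2 + d3 * d2).
    by rewrite /al /be; ring.
  by apply: rpredD; last apply: dvdz_mulr.
have : [&& (3 %| d0 - d3 - d1), (3 %| d1 + d0 - d2),
           (3 %| d2 + d1 - d3) & (3 %| d3 + d2 + d0)]%Z.
  by move: dvd_u dvd_v; rewrite /u /v; clear; lia.
case/and4P=> /dvdzP[e0 E0] /dvdzP[e1 E1] /dvdzP[e2 E2] /dvdzP[e3 E3].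
exists e0, e1, e2, e3; apply: scale (And4 E0 E1 E2 E3) _.
by rewrite /norm8 /relre /relim; ring.
Qed.

(** The factor 2 is removed with 1 + z. An odd k is 1 modulo 8, as both p and odd
norms are, hence 1 or 9, and the factor 9 is removed with 1 + t or 1 - t. *)
Lemma norm8_descent (p k : nat) (d0 d1 d2 d3 : int) : prime p -> (p %% 8 = 1)%N ->
  (0 < k < 16)%N -> norm8 d0 d1 d2 d3 = k%:Z * p%:Z ->
  exists e0 e1 e2 e3, norm8 e0 e1 e2 e3 = p%:Z.
Proof.
move=> p_pr p1; have [n] := ubnP k.
elim: n k d0 d1 d2 d3 => // n IHn k d0 d1 d2 d3.
rewrite ltnS => le_kn /andP[k_gt0 k_lt] def_d.
have [j def_p] : exists j, p = (8 * j + 1)%N.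
  by exists (p %/ 8)%N; clear - p1; lia.
have [k_odd|k_even] := boolP (odd k); last first.
  have def_k : k%:Z = 2 * k./2%:Z by clear - k_even; lia.
  have [|e0 [e1 [e2 [e3 def_e]]]] := @norm8_even d0 d1 d2 d3 (k./2%:Z * p%:Z).
    by rewrite def_d def_k; ring.
  apply: IHn def_e; first by clear - le_kn k_gt0; lia.
  by clear - def_k k_gt0 k_lt; lia.
have [|m def_m] := @norm8_odd d0 d1 d2 d3 ((k%:Z * p%:Z - 1) %/ 2)%Z.
  by rewrite def_d def_p; clear - k_odd; lia.
have [k1|k9] : (k = 1 \/ k = 9)%N.
  by move: def_d; rewrite def_m def_p; clear - k_odd k_lt; lia.
- by exists d0, d1, d2, d3; rewrite def_d k1 mul1r.
have [|e0 [e1 [e2 [e3 def_e]]]] := @norm8_dvd3 d0 d1 d2 d3 (3 * p%:Z).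
  by rewrite def_d k9; ring.
by exists e0, e1, e2, e3; apply: (@mulfI _ 9) => //; rewrite -def_e def_d k9.
Qed.

(** With r^4 = -1 modulo p, the pigeonhole principle yields a small nonzero element
in the kernel of z -> r. Its norm N is a multiple of p, and
N = S^2 - 2 T^2 <= S^2 where S is the sum of the squares of the coordinates, so
N < 16 p when these are at most the fourth root of p. *)
Lemma prime_is_norm8 p : prime p -> (p %% 8 = 1)%N ->
  exists d0 d1 d2 d3, norm8 d0 d1 d2 d3 = p%:Z.
Proof.
move=> p_pr p1.
have [|r dvd_r] := root_Xn_add1 p_pr (isT : (0 < 4)%N).
  by apply/dvdnP; exists (p %/ 8)%N; clear - p1; lia.
have [k /andP[ltkp ltpk]] := prime_root_bounds p_pr (isT : (1 < 4)%N).
have [|d [[i nz_i] led dvd]] := @thue_pigeonhole 4 k p (fun i => r ^+ i).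
  by rewrite prime_gt0.
have {i nz_i led dvd} [d0 [d1 [d2 [d3 [nz le_d dvd_d]]]]] : exists d0 d1 d2 d3 : int,
  [/\ ~ [/\ d0 = 0, d1 = 0, d2 = 0 & d3 = 0],
    [/\ (`|d0| <= k)%N, (`|d1| <= k)%N, (`|d2| <= k)%N & (`|d3| <= k)%N]
  & (p %| d0 + r * d1 + r ^+ 2 * d2 + r ^+ 3 * d3)%Z].
  exists (d (@Ordinal 4 0 isT)), (d (@Ordinal 4 1 isT)),
    (d (@Ordinal 4 2 isT)), (d (@Ordinal 4 3 isT)).
  split=> //.
    case=> z0 z1 z2 z3; case/eqP: nz_i; case: i => -[|[|[|[|//]]]] lti;
      by rewrite (bool_irrelevance lti isT) ?z0 ?z1 ?z2 ?z3.
  move: dvd; rewrite !big_ord_recr big_ord0 /= add0r mul1r expr1.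
  by congr (_ %| d _ + _ * d _ + _ * d _ + _ * d _)%Z; apply: val_inj.
have dvd_N : (p %| norm8 d0 d1 d2 d3)%Z.
  have dvd_rel : (p %| relre d0 d1 d2 d3 - r ^+ 2 * relim d0 d1 d2 d3)%Z.
    have -> : relre d0 d1 d2 d3 - r ^+ 2 * relim d0 d1 d2 d3
      = (d0 + r * d1 + r ^+ 2 * d2 + r ^+ 3 * d3)
        * (d0 - r * d1 + r ^+ 2 * d2 - r ^+ 3 * d3)
        - (r ^+ 4 + 1) * (d2 ^+ 2 - 2 * d1 * d3 - d3 ^+ 2 * r ^+ 2).
      by rewrite /relre /relim; ring.
    by apply: rpredB; apply: dvdz_mulr.
  have -> : norm8 d0 d1 d2 d3 = (relre d0 d1 d2 d3 - r ^+ 2 * relim d0 d1 d2 d3)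
      * (relre d0 d1 d2 d3 + r ^+ 2 * relim d0 d1 d2 d3)
      + (r ^+ 4 + 1) * relim d0 d1 d2 d3 ^+ 2 by rewrite /norm8; ring.
  by apply: rpredD; apply: dvdz_mulr.
have N_gt0 : 0 < norm8 d0 d1 d2 d3.
  rewrite lt0r addr_ge0 ?sqr_ge0 // andbT; apply/eqP=> /norm8_eq0; exact: nz.
have [q def_q] := dvdzP dvd_N.
have N_lt : norm8 d0 d1 d2 d3 < 16 * p%:Z.
  have sqr_le (u : int) : (`|u| <= k)%N -> u ^+ 2 <= k%:Z ^+ 2.
    move=> le_u; rewrite -(@real_normK _ u) ?num_real //.
    by rewrite ler_pXn2r ?nnegrE // -abszE lez_nat.
  case: le_d => /sqr_le le0 /sqr_le le1 /sqr_le le2 /sqr_le le3.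
  pose S := d0 ^+ 2 + d1 ^+ 2 + d2 ^+ 2 + d3 ^+ 2.
  have S_ge0 : 0 <= S by rewrite !addr_ge0 ?sqr_ge0.
  have S_le : S <= 4 * k%:Z ^+ 2 by rewrite /S; clear - le0 le1 le2 le3; lia.
  have N_le : norm8 d0 d1 d2 d3 <= S ^+ 2.
    rewrite -subr_ge0.
    have -> : S ^+ 2 - norm8 d0 d1 d2 d3
        = 2 * (d0 * d1 + d1 * d2 + d2 * d3 - d0 * d3) ^+ 2.
      by rewrite /S /norm8 /relre /relim; ring.
    by rewrite mulr_ge0 ?sqr_ge0.
  apply: le_lt_trans N_le _; apply: le_lt_trans (_ : (4 * k%:Z ^+ 2) ^+ 2 < _).
    by rewrite ler_pXn2r ?nnegrE // (le_trans S_ge0 S_le).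
  have -> : (4 * k%:Z ^+ 2) ^+ 2 = 16 * k%:Z ^+ 4 by ring.
  by rewrite ltr_pM2l // -natrX ltr_nat.
have p_gt0 : 0 < p%:Z by rewrite ltz_nat prime_gt0.
rewrite def_q in N_gt0 N_lt.
rewrite pmulr_lgt0 // in N_gt0; rewrite ltr_pM2r // in N_lt.
apply: (@norm8_descent p `|q| d0 d1 d2 d3) => //; last by rewrite def_q gtz0_abs.
by clear - N_gt0 N_lt; lia.
Qed.

(** * Residues 3 and -3 modulo 8 and Gaussian integers *)

Definition pm3 (s : int) : Prop := (s = 3 %[mod 8])%Z \/ (s = - 3 %[mod 8])%Z.

Lemma pm3_dec (n : int) : pm3 n \/ ~ pm3 n.
Proof. by rewrite /pm3; lia. Qed.

Lemma pm3N (s : int) : pm3 s -> pm3 (- s).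
Proof. by rewrite /pm3; lia. Qed.

Lemma pm3_add8 (s t : int) : (8 %| t - s)%Z -> pm3 s -> pm3 t.
Proof. by rewrite /pm3; lia. Qed.

Lemma not_pm3 (n : int) : ~ pm3 (2 * n + 1) ->
  exists j, 2 * n + 1 = 8 * j + 1 \/ 2 * n + 1 = 8 * j - 1.
Proof. by move=> ok; exists ((2 * n + 2) %/ 8)%Z; move: ok; rewrite /pm3; lia. Qed.

Lemma not_pm3_sqr (n : int) : ~ pm3 (2 * n + 1) ->
  exists k, (2 * n + 1) ^+ 2 = 16 * k + 1.
Proof.
by case/not_pm3=> j [] ->; [exists (4 * j ^+ 2 + j) | exists (4 * j ^+ 2 - j)]; ring.
Qed.

(** The condition on a + b is a property of p alone: changing the sign of the term
divisible by 4 changes the sum by a multiple of 8. *)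
Lemma pm3_two_squares p (a b c d : int) : prime p -> (p %% 8 = 1)%N ->
  p%:Z = a ^+ 2 + b ^+ 2 -> p%:Z = c ^+ 2 + d ^+ 2 -> pm3 (a + b) -> pm3 (c + d).
Proof.
move=> p_pr p1 def_p def_p' bad.
wlog cc_aa : a b def_p bad / c ^+ 2 = a ^+ 2.
  move=> IH; have [|cc_bb] := two_squares_unique p_pr def_p def_p'.
    exact: (IH a b).
  by apply: (IH b a) => //; rewrite addrC.
have dd_bb : d ^+ 2 = b ^+ 2.
  by apply: (@addrI _ (c ^+ 2)); rewrite -def_p' cc_aa def_p.
have four : (4 %| a)%Z || (4 %| b)%Z.
  have [a' [a_even|a_odd]] := parity a; last first.
    by rewrite (@dvd4_even_term p a b) ?orbT //; exists a'.
  have [b' [b_even|b_odd]] := parity b.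
    by move: def_p p1; rewrite a_even b_even; clear; lia.
  by rewrite (@dvd4_even_term p b a) ?orbT //; [rewrite addrC | exists b'].
move/eqP: cc_aa; move/eqP: dd_bb; rewrite !eqf_sqr.
move=> /pred2P def_d /pred2P def_c; have badN := pm3N bad.
case/orP: four => /dvdzP[q def_q].
- case: def_d => ->.
    by apply: pm3_add8 bad; case: def_c => ->; rewrite def_q; clear; lia.
  by apply: pm3_add8 badN; case: def_c => ->; rewrite def_q; clear; lia.
- case: def_c => ->.
    by apply: pm3_add8 bad; case: def_d => ->; rewrite def_q; clear; lia.
  by apply: pm3_add8 badN; case: def_d => ->; rewrite def_q; clear; lia.
Qed.

(** The odd cofactors of 2^11 in the theorem are the odd multiples of these
numbers. They are the norms of those Gaussian primes that have an associate or
conjugate a + b i with a + b equal to 3 or -3 modulo 8. *)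
Inductive exceptional (e : int) : Prop :=
| ExcSplit (p : nat) (a b : int) of prime p & p%:Z = a ^+ 2 + b ^+ 2
    & (p%:Z = 1 %[mod 8])%Z & pm3 (a + b) & e = p%:Z
| ExcInert5 (p : nat) of prime p & (p%:Z = - 3 %[mod 8])%Z & e = p%:Z
| ExcInert3 (p : nat) of prime p & (p%:Z = 3 %[mod 8])%Z & e = p%:Z ^+ 2.

(** The quotient of a + b i by c + d i is (a + b i)(c - d i) / p; both parts are
integers because the norm p (a^2 + b^2) of the numerator is divisible by p^2. *)
Lemma gauss_quotient p (a b c d : int) : prime p -> p%:Z = c ^+ 2 + d ^+ 2 ->
  (p %| a ^+ 2 + b ^+ 2)%Z -> (p %| a * c + b * d)%Z ->
  exists e f, [/\ a = e * c - f * d, b = e * d + f * c &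
    a ^+ 2 + b ^+ 2 = p%:Z * (e ^+ 2 + f ^+ 2)].
Proof.
move=> p_pr def_p dvdN dvdx.
have nz_p : p%:Z != 0 by rewrite eqz_nat -lt0n prime_gt0.
have normM : (b * c - a * d) ^+ 2
    = p%:Z * (a ^+ 2 + b ^+ 2) - (a * c + b * d) * (a * c + b * d).
  by rewrite def_p; ring.
have dvdy : (p %| b * c - a * d)%Z.
  suff: (p %| (b * c - a * d) ^+ 2)%Z by rewrite expr2 Euclid_dvdzM // orbb.
  rewrite normM.
  by apply: rpredB; [apply: dvdz_mulr (dvdzz _) | apply: dvdz_mulr].
have [e def_e] := dvdzP dvdx; have [f def_f] := dvdzP dvdy.
exists e, f; split; apply: (mulfI nz_p).
- by transitivity ((e * p%:Z) * c - (f * p%:Z) * d);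
    [rewrite -def_e -def_f def_p; ring | ring].
- by transitivity ((e * p%:Z) * d + (f * p%:Z) * c);
    [rewrite -def_e -def_f def_p; ring | ring].
- transitivity ((e * p%:Z) ^+ 2 + (f * p%:Z) ^+ 2); last by ring.
  by rewrite -def_e -def_f def_p; ring.
Qed.

(** Descent on the norm. A prime divisor p of the norm that is 5 modulo 8 is
exceptional; one that is 3 modulo 4 divides a and b, so its square is
exceptional if p = 3 modulo 8 and p can be divided out if p = 7 modulo 8. If
p = 1 modulo 8, then p = c^2 + d^2 with 4 | d; unless p itself is exceptional,
c + d is 1 or -1 modulo 8, and dividing by c + d i or by c - d i preserves the
class of a + b up to sign because
a + b = (e + f)(c + d) - 2 f d and 2 d is divisible by 8. *)
Lemma exceptional_divisor (a b : int) : pm3 (a + b) ->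
  exists2 e, exceptional e & (e %| a ^+ 2 + b ^+ 2)%Z.
Proof.
have [n] := ubnP (absz (a ^+ 2 + b ^+ 2)); elim: n a b => // n IHn a b ltNn bad_ab.
set N := a ^+ 2 + b ^+ 2 in ltNn *.
have N_gt1 : 1 < N.
  have : (a + b) ^+ 2 + (a - b) ^+ 2 = 2 * N by rewrite /N; ring.
  have := sqr_ge0 (a - b); have : 9 <= (a + b) ^+ 2.
    have [] : 3 <= a + b \/ a + b <= - 3 by clear - bad_ab; case: bad_ab; lia.
    - by clear; nia.
    - by clear; nia.
  by clear; lia.
have N1 : (1 < `|N|)%N by lia.
have p_pr := pdiv_prime N1; have dvd_pN := pdiv_dvd `|N|.
set p := pdiv _ in p_pr dvd_pN.
have p_gt1 := prime_gt1 p_pr; have p_gt0 := prime_gt0 p_pr.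
have {}dvd_pN : (p %| N)%Z by rewrite dvdzE.
have p_odd : odd p.
  have [p2|//] := even_prime p_pr; move: dvd_pN; rewrite p2 /N.
  have -> : a ^+ 2 + b ^+ 2 = (a + b) * (a + b) - 2 * (a * b) by ring.
  case: bad_ab; clear; have [k [->|->]] := parity (a + b); lia.
(* The induction hypothesis for a + b i divided by an element of norm q. *)
have IH (e f : int) (q : nat) :
    (1 < q)%N -> N = q%:Z * (e ^+ 2 + f ^+ 2) -> pm3 (e + f) ->
    exists2 e, exceptional e & (e %| N)%Z.
  move=> q_gt1 def_N bad_ef; have [||u exc_u dvd_u] := IHn e f => //.
    by move: ltNn N_gt1; rewrite def_N; clear - q_gt1; nia.
  by exists u; rewrite // def_N dvdz_mull.
have [p1|p3] : (p %% 4 = 1 \/ p %% 4 = 3)%N by clear - p_odd; lia.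
  have [p1'|p5] : (p %% 8 = 1 \/ p %% 8 = 5)%N by clear - p1; lia.
    have [c [d [def_p d4]]] : exists c d : int, p%:Z = c ^+ 2 + d ^+ 2 /\ (4 %| d)%Z.
      have [c [d def_p]] := two_squares p_pr p1.
      have [c_odd|d_odd] : (exists c', c = 2 * c' + 1)
          \/ (exists d', d = 2 * d' + 1).
        have [c' [c_even|]] := parity c; last by left; exists c'.
        have [d' [d_even|]] := parity d; last by right; exists d'.
        by move: def_p p1; rewrite c_even d_even; clear; lia.
      - by exists c, d; split=> //; apply: (dvd4_even_term p1' def_p).
      - exists d, c; rewrite addrC; split=> //.
        by apply: (dvd4_even_term p1' _ d_odd); rewrite addrC.
    have [bad_cd | good_cd] : pm3 (c + d)
        \/ (c + d = 1 %[mod 8])%Z \/ (c + d = - 1 %[mod 8])%Z.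
    - have [c' [c_even|->]] := parity c.
        by move: def_p p1; case/dvdzP: d4 => d' ->; rewrite c_even; clear; lia.
      by move: d4; rewrite /pm3; clear; lia.
    - exists p%:Z => //; apply: (ExcSplit p_pr def_p) => //; clear - p1'; lia.
    (* d' is d or - d, according to which of c + d i and c - d i divides a + b i. *)
    have step (d' : int) : d' = d \/ d' = - d -> (p %| a * c + b * d')%Z ->
        exists2 e, exceptional e & (e %| N)%Z.
      move=> def_d' dvd_acbd.
      have [|e [f [def_a def_b def_N]]] := gauss_quotient p_pr _ dvd_pN dvd_acbd.
        by rewrite def_p; case: def_d' => ->; rewrite ?sqrrN.
      have [j good_d'] : exists j, c + d' = 8 * j + 1 \/ c + d' = 8 * j - 1.
        by exists ((c + d' + 1) %/ 8)%Z; clear - good_cd d4 def_d'; lia.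
      apply: (IH e f p) => //; move: bad_ab good_d'; rewrite def_a def_b.
      have [k ->] : exists k, d' = 4 * k.
        case/dvdzP: d4 => k def_d.
        by case: def_d' => ->; rewrite def_d; [exists k | exists (- k)]; ring.
      move=> + good_d'; have -> : e * c - f * (4 * k) + (e * (4 * k) + f * c)
          = (e + f) * (c + 4 * k) - 8 * (f * k) by ring.
      by case: good_d' => ->; rewrite /pm3; clear; lia.
    have : (p %| (a * c + b * d) * (a * c + b * - d))%Z.
      have -> : (a * c + b * d) * (a * c + b * - d)
          = c ^+ 2 * N - b ^+ 2 * p%:Z by rewrite def_p /N; ring.
      by apply: rpredB; apply: dvdz_mull.
    by rewrite Euclid_dvdzM // => /orP[]; apply: step; [left | right].
  exists p%:Z => //; apply: (ExcInert5 p_pr) => //; clear - p5; lia.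
have [/dvdzP[a' def_a] /dvdzP[b' def_b]] := inert_dvd p_pr p3 dvd_pN.
have def_N : N = p%:Z ^+ 2 * (a' ^+ 2 + b' ^+ 2) by rewrite /N def_a def_b; ring.
have [p3'|p7] : (p %% 8 = 3 \/ p %% 8 = 7)%N by clear - p3; lia.
  exists (p%:Z ^+ 2); last by rewrite def_N dvdz_mulr.
  by apply: (ExcInert3 p_pr) => //; clear - p3'; lia.
apply: (IH a' b' (p ^ 2)%N).
- by rewrite (ltn_exp2l 0).
- by rewrite def_N; congr (_ * _); rewrite -natrXE.
have [k def_p] : exists k, p%:Z = 8 * k - 1.
  by exists ((p %/ 8)%N.+1%:Z); clear - p7; lia.
by move: bad_ab; rewrite def_a def_b def_p /pm3; clear; lia.
Qed.

(** Division by 1 + i turns the parts 2 r + 1 and 2 s + 1 of a Gaussian integer into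
parts whose sum or difference is again one of these two numbers. *)
Lemma exceptional_half_norm (r s : int) : pm3 (2 * r + 1) \/ pm3 (2 * s + 1) ->
  exists2 e, exceptional e & (e %| 2 * (r ^+ 2 + r + s ^+ 2 + s) + 1)%Z.
Proof.
have -> : 2 * (r ^+ 2 + r + s ^+ 2 + s) + 1 = (r + s + 1) ^+ 2 + (s - r) ^+ 2.
  ring.
case=> bad; last first.
  by apply: exceptional_divisor; rewrite (_ : _ + _ = 2 * s + 1) //; ring.
rewrite -[(s - r) ^+ 2]sqrrN; apply: exceptional_divisor.
by rewrite (_ : _ + _ = 2 * r + 1) //; ring.
Qed.

(** * Odd determinants *)

(** Multiplication of F by x modulo x^8 - 1. *)
Definition rot (c : nat -> int) (i : nat) : int := if i is j.+1 then c j else c 7%N.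

Lemma det8_rot (c : nat -> int) : det8 (rot c) = - det8 c.
Proof. by unfold_det8; rewrite /rot; ring. Qed.

(** If n = u v with n = 9 modulo 16 and u = 5 modulo 8, then v = 5 modulo 8 as
well, and n = 9 modulo 16 forces k = l modulo 2. *)
Lemma setA_of_divisor (u n : int) : pm3 u -> (u %| n)%Z -> (n = 1 %[mod 8])%Z ->
  (exists m, n = 16 * m + 1) \/ setA n.
Proof.
move=> bad_u dvd_un n1.
have [[m def_m]|[m def_m]] : (exists m, n = 16 * m + 1) \/ (exists m, n = 16 * m + 9).
- have [k [def_k|def_k]] := parity (n %/ 8)%Z; [left | right]; exists k;
    by clear - n1 def_k; lia.
- by left; exists m.
right; have [w [k def_w] /dvdzP[v def_v]] :
    exists2 w, exists k, w = 8 * k - 3 & (w %| n)%Z.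
  case: bad_u => bad_u.
    exists (- u); last by rewrite dvdzE abszN -dvdzE.
    by exists ((- u + 3) %/ 8)%Z; clear - bad_u; lia.
  by exists u; first by exists ((u + 3) %/ 8)%Z; clear - bad_u; lia.
have [l def_l] : exists l, v = 8 * l - 3.
  exists ((v + 3) %/ 8)%Z; move: def_m; rewrite def_v def_w; clear; lia.
exists l, k; split; last by rewrite def_v def_l def_w.
by move: def_m; rewrite def_v def_w def_l; clear; lia.
Qed.

(** Write e_i = c_i + c_(i + 4). Up to multiplying F by a power of x, an odd F has e0
odd, e2 even and e1 + e3 even. The relation between [t] and [t'] comes from
(e0 + e2)^2 - (e0 - e2)^2 = 4 e0 e2, where e0 + e2 and e0 - e2 are the parts of
F(1) and F(i) with even exponents. *)
Lemma odd_shape (c : nat -> int) (a b f m : int) :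
  c 0%N + c 4%N = 2 * a + 1 -> c 2%N + c 6%N = 2 * b ->
  c 1%N + c 5%N = f -> c 3%N + c 7%N = 2 * m - f ->
  exists r i t t' : int,
  [/\ Fz_re c = 8 * r + 1 - 4 * (b - c 6%N) ^+ 2
              + 2 * (f - 2 * c 5%N) * (2 * m - f - 2 * c 7%N),
      Fz_im c = 4 * i,
      sum8 c * alt8 c = 8 * t + 1 - 4 * m ^+ 2,
      gre c ^+ 2 + gim c ^+ 2 = 8 * t' + 1 + 4 * (f - m) ^+ 2
    & t = t' + (2 * a + 1) * b].
Proof.
move=> e0 e2 e1 e3.
have c0 : c 0%N = 2 * a + 1 - c 4%N by rewrite -e0; ring.
have c2 : c 2%N = 2 * b - c 6%N by rewrite -e2; ring.
have c1 : c 1%N = f - c 5%N by rewrite -e1; ring.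
have c3 : c 3%N = 2 * m - f - c 7%N by rewrite -e3; ring.
have [r def_r] := odd_square (a - c 4%N).
have [t' def_t'] := odd_square (a - b).
exists r, ((f - m - c 5%N + c 7%N) * (m - c 5%N - c 7%N)
  - (2 * (a - c 4%N) + 1) * (b - c 6%N)).
exists (t' + (2 * a + 1) * b), t'; split=> //.
- rewrite -[8 * r + 1]def_r; unfold_det8; rewrite c0 c1 c2 c3; ring.
- unfold_det8; rewrite c0 c1 c2 c3; ring.
- transitivity (8 * t' + 1 + 8 * ((2 * a + 1) * b) - 4 * m ^+ 2); last by ring.
  rewrite -def_t'; unfold_det8; rewrite c0 c1 c2 c3; ring.
- rewrite -def_t'; unfold_det8; rewrite c0 c1 c2 c3; ring.
Qed.

(** Modulo 8 the product of the factors is 1 - 4 m^2 + 4 (f - m)^2 = 1 + 4 f. *)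
Lemma det8_mod8 (c : nat -> int) (a b f m : int) :
  c 0%N + c 4%N = 2 * a + 1 -> c 2%N + c 6%N = 2 * b ->
  c 1%N + c 5%N = f -> c 3%N + c 7%N = 2 * m - f ->
  exists k, det8 c = 1 + 4 * f + 8 * k.
Proof.
move=> e0 e2 e1 e3.
have [r [i [t [t' [def_r def_i def_t def_t' _]]]]] := odd_shape e0 e2 e1 e3.
have [w def_w] : exists w, Fz_re c ^+ 2 + Fz_im c ^+ 2 = 8 * w + 1.
  have [h odd_r] : exists h, Fz_re c = 2 * h + 1.
    exists (4 * r - 2 * (b - c 6%N) ^+ 2
      + (f - 2 * c 5%N) * (2 * m - f - 2 * c 7%N)).
    by rewrite def_r; ring.
  have [h' def_h] := odd_square h.
  by exists (h' + 2 * i ^+ 2); rewrite odd_r def_h def_i; ring.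
rewrite det8E def_t def_t' def_w.
have [v def_v] := pronic_even f.
suff: (8 %| (8 * t + 1 - 4 * m ^+ 2) * (8 * t' + 1 + 4 * (f - m) ^+ 2)
    * (8 * w + 1) - 1 - 4 * f)%Z.
  by case/dvdzP=> k def_k; exists k; clear - def_k; lia.
by clear - def_v; lia.
Qed.

(** The hypotheses make m and f even. Then the three factors are 1 + 8 t, 1 + 8 t'
and 1 + 8 (b - c6) modulo 16, and t - t' = b modulo 2, so that b cancels. *)
Lemma det8_mod16 (c : nat -> int) (a b f m : int) :
  c 0%N + c 4%N = 2 * a + 1 -> c 2%N + c 6%N = 2 * b ->
  c 1%N + c 5%N = f -> c 3%N + c 7%N = 2 * m - f ->
  ~ pm3 (sum8 c) -> ~ pm3 (alt8 c) ->
  ~ pm3 (gre c ^+ 2 + gim c ^+ 2) -> exists k, det8 c = 1 + 8 * c 6%N + 16 * k.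
Proof.
move=> e0 e2 e1 e3.
have [r [i [t [t' [def_r def_i def_t def_t' def_tt]]]]] := odd_shape e0 e2 e1 e3.
have -> : sum8 c = 2 * (a + b + m) + 1.
  transitivity (c 0%N + c 4%N + (c 2%N + c 6%N) + (c 1%N + c 5%N) + (c 3%N + c 7%N)).
    by unfold_det8; ring.
  by rewrite e0 e1 e2 e3; ring.
have -> : alt8 c = 2 * (a + b - m) + 1.
  transitivity (c 0%N + c 4%N + (c 2%N + c 6%N) - (c 1%N + c 5%N) - (c 3%N + c 7%N)).
    by unfold_det8; ring.
  by rewrite e0 e1 e2 e3; ring.
move=> /not_pm3[j def_j] /not_pm3[j' def_j']; rewrite det8E def_t def_t' => ok_g.
have [mu def_mu] : exists mu, m = 2 * mu.
  by exists (m %/ 2)%Z; clear - def_j def_j'; lia.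
have [phi def_phi] : exists phi, f = 2 * phi.
  exists (f %/ 2)%Z; move: ok_g; rewrite /pm3 def_mu.
  have [x [->|->]] := parity f; clear; lia.
have [q def_q] : exists q, Fz_re c ^+ 2 = 16 * q + 1 + 8 * (b - c 6%N).
  have [p def_p] := pronic_even (b - c 6%N).
  pose h := r + (phi - c 5%N) * (2 * mu - phi - c 7%N).
  have -> : Fz_re c = 8 * h + 1 - 4 * (b - c 6%N) ^+ 2.
    by rewrite def_r def_mu def_phi /h; ring.
  (* (8 h + 1 - 4 B^2)^2 = 1 - 8 B^2 modulo 16, and B^2 = B modulo 2. *)
  pose B := b - c 6%N; rewrite -/B in def_p *.
  exists (4 * h ^+ 2 + B ^+ 2 * B ^+ 2 + h - 4 * h * B ^+ 2 - p).
  transitivity (64 * h ^+ 2 + 16 * (B ^+ 2 * B ^+ 2) + 16 * h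
    - 64 * h * B ^+ 2 + 1 - 8 * (B * B + B) + 8 * B); first by ring.
  by rewrite def_p; ring.
rewrite def_i def_q def_tt def_mu def_phi.
suff: (16 %| (8 * (t' + (2 * a + 1) * b) + 1 - 4 * (2 * mu) ^+ 2) *
  (8 * t' + 1 + 4 * (2 * phi - 2 * mu) ^+ 2) *
  (16 * q + 1 + 8 * (b - c 6%N) + (4 * i) ^+ 2) - 1 - 8 * c 6%N)%Z.
  by case/dvdzP=> k def_k; exists k; clear - def_k; lia.
by clear; lia.
Qed.

Lemma det8_factors (c : nat -> int) : [/\ (sum8 c %| det8 c)%Z, (alt8 c %| det8 c)%Z
  & (gre c ^+ 2 + gim c ^+ 2 %| det8 c)%Z].
Proof.
rewrite det8E; split; apply: dvdz_mulr; last exact: dvdz_mull (dvdzz _).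
  by apply: dvdz_mulr; apply: dvdz_mulr (dvdzz _).
by apply: dvdz_mulr; apply: dvdz_mull (dvdzz _).
Qed.

(** Both vectors have the same f and the same c6 modulo 2, so the two values of
det8 agree modulo 8, and modulo 16 in the absence of a divisor that is 3 or -3
modulo 8. *)
Lemma odd_group_det_core (x y : nat -> int) (n a b m : int) :
  let c i := x i + y i in
  n = det8 c * det8 (fun i => x i - y i) ->
  c 0%N + c 4%N = 2 * a + 1 -> c 2%N + c 6%N = 2 * b ->
  c 1%N + c 5%N + (c 3%N + c 7%N) = 2 * m ->
  (exists m, n = 16 * m + 1) \/ setA n.
Proof.
move=> c; set c' := fun i => x i - y i => def_n e0 e2 e13.
pose f := c 1%N + c 5%N.
have e3 : c 3%N + c 7%N = 2 * m - f by rewrite -e13 /f; ring.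
pose f' := f - 2 * (y 1%N + y 5%N).
pose m' := m - (y 1%N + y 5%N + y 3%N + y 7%N).
have c'E i : c' i = c i - 2 * y i by rewrite /c /c'; ring.
have e0' : c' 0%N + c' 4%N = 2 * (a - y 0%N - y 4%N) + 1.
  by rewrite !c'E; move: e0; clear; lia.
have e2' : c' 2%N + c' 6%N = 2 * (b - y 2%N - y 6%N).
  by rewrite !c'E; move: e2; clear; lia.
have e1' : c' 1%N + c' 5%N = f' by rewrite /f' /f !c'E; ring.
have e3' : c' 3%N + c' 7%N = 2 * m' - f'.
  by rewrite /f' /m' !c'E; move: e3; clear; lia.
have n1 : (n = 1 %[mod 8])%Z.
  have [k def_k] := det8_mod8 e0 e2 erefl e3.
  have [k' def_k'] := det8_mod8 e0' e2' e1' e3'.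
  rewrite def_n def_k def_k' /f' -/f; clear.
  by have [h [->|->]] := parity f; lia.
have bad u : pm3 u -> (u %| det8 c)%Z || (u %| det8 c')%Z ->
    (exists m, n = 16 * m + 1) \/ setA n.
  move=> bad_u dvd_u; apply: setA_of_divisor bad_u _ n1; rewrite def_n.
  by case/orP: dvd_u => dvd_u; [apply: dvdz_mulr | apply: dvdz_mull].
have [cp cq cg] := det8_factors c; have [cp' cq' cg'] := det8_factors c'.
have [/bad bad_p|ok_p] := pm3_dec (sum8 c).
  by apply: bad_p; rewrite cp.
have [/bad bad_p|ok_q] := pm3_dec (alt8 c).
  by apply: bad_p; rewrite cq.
have [/bad bad_p|ok_g] := pm3_dec (gre c ^+ 2 + gim c ^+ 2).
  by apply: bad_p; rewrite cg.
have [/bad bad_p|ok_p'] := pm3_dec (sum8 c').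
  by apply: bad_p; rewrite cp' orbT.
have [/bad bad_p|ok_q'] := pm3_dec (alt8 c').
  by apply: bad_p; rewrite cq' orbT.
have [/bad bad_p|ok_g'] := pm3_dec (gre c' ^+ 2 + gim c' ^+ 2).
  by apply: bad_p; rewrite cg' orbT.
left; have [k def_k] := det8_mod16 e0 e2 erefl e3 ok_p ok_q ok_g.
have [k' def_k'] := det8_mod16 e0' e2' e1' e3' ok_p' ok_q' ok_g'.
have [h def_h] : exists h, n = 1 + 16 * h; last by exists h; rewrite def_h addrC.
rewrite def_n def_k def_k' c'E; move: (c 6%N) (y 6%N) => u v.
exists (k + k' + u - v + 4 * u ^+ 2 - 8 * u * v + 8 * u * k'
  + 8 * k * (u - 2 * v) + 16 * k * k').
ring.
Qed.

(** Exactly one of e0 + e2 and e1 + e3 is odd. Multiplying both polynomials by a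
power of x cyclically permutes e0, e1, e2, e3 and preserves the product, which
brings the odd summand of this odd sum to position 0. *)
Lemma odd_group_det (x y : nat -> int) (n : int) :
  n = det8 (fun i => x i + y i) * det8 (fun i => x i - y i) ->
  ~~ (2 %| sum8 x + sum8 y)%Z -> (exists m, n = 16 * m + 1) \/ setA n.
Proof.
pose c (x y : nat -> int) i := x i + y i.
have core (u v : nat -> int) : n = det8 (c u v) * det8 (fun i => u i - v i) ->
    ~~ (2 %| c u v 0%N + c u v 4%N)%Z -> (2 %| c u v 2%N + c u v 6%N)%Z ->
    (2 %| c u v 1%N + c u v 5%N + (c u v 3%N + c u v 7%N))%Z ->
    (exists m, n = 16 * m + 1) \/ setA n.
  move=> def_n odd0 even2 even13.
  apply: (@odd_group_det_core u v n ((c u v 0%N + c u v 4%N) %/ 2)%Z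
    ((c u v 2%N + c u v 6%N) %/ 2)%Z
    ((c u v 1%N + c u v 5%N + (c u v 3%N + c u v 7%N)) %/ 2)%Z def_n).
  - rewrite -[LHS]/(c u v 0%N + c u v 4%N).
    by move: (_ + _) odd0 => s; clear; lia.
  - by rewrite mulrC divzK.
  - by rewrite mulrC divzK.
have rotE (u v : nat -> int) : det8 (c u v) * det8 (fun i => u i - v i)
    = det8 (c (rot u) (rot v)) * det8 (fun i => rot u i - rot v i).
  by rewrite -mulrNN -!det8_rot.
move=> def_n odd_sum; have def_n1 := etrans def_n (rotE _ _).
have def_n2 := etrans def_n1 (rotE _ _); have def_n3 := etrans def_n2 (rotE _ _).
have sum_c : sum8 x + sum8 y = c x y 0%N + c x y 4%N + (c x y 1%N + c x y 5%N)
    + (c x y 2%N + c x y 6%N) + (c x y 3%N + c x y 7%N).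
  by rewrite /sum8 /c; ring.
rewrite {}sum_c in odd_sum.
have e0 := core _ _ def_n; have e3 := core _ _ def_n1.
have e2 := core _ _ def_n2; have e1 := core _ _ def_n3.
rewrite /c /= in e0 e1 e2 e3 odd_sum.
clear core rotE def_n def_n1 def_n2 def_n3 c.
move: odd_sum e0 e1 e2 e3; set concl := _ \/ _.
rewrite ![x 5%N + y 5%N + (x 1%N + _)]addrC ![x 6%N + y 6%N + (x 2%N + _)]addrC.
rewrite ![x 7%N + y 7%N + (x 3%N + _)]addrC.
move: (x 0%N + y 0%N + _) (x 1%N + y 1%N + _) (x 2%N + y 2%N + _) (x 3%N + y 3%N + _).
move=> f0 f1 f2 f3; clear.
move=> odd_sum core0 core1 core2 core3.
have : [|| [&& ~~ (2 %| f0)%Z, (2 %| f2)%Z & (2 %| f1 + f3)%Z],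
   [&& ~~ (2 %| f1)%Z, (2 %| f3)%Z & (2 %| f2 + f0)%Z],
   [&& ~~ (2 %| f2)%Z, (2 %| f0)%Z & (2 %| f3 + f1)%Z] |
   [&& ~~ (2 %| f3)%Z, (2 %| f1)%Z & (2 %| f0 + f2)%Z]].
  by clear - odd_sum; lia.
by case/or4P=> /and3P[odd0 even2 even13];
  [apply: core0 | apply: core1 | apply: core2 | apply: core3].
Qed.

(** * Even determinants *)

(** Here each of F(1) F(-1), |F(i)|^2 and N(F(z)) is divisible by 4. *)
Lemma det8_dvd64 (c : nat -> int) (a b : int) :
  c 0%N + c 2%N + c 4%N + c 6%N = 2 * a -> c 1%N + c 3%N + c 5%N + c 7%N = 2 * b ->
  (64 %| det8 c)%Z.
Proof.
move=> def_a def_b.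
have c0 : c 0%N = 2 * a - c 2%N - c 4%N - c 6%N by rewrite -def_a; ring.
have c1 : c 1%N = 2 * b - c 3%N - c 5%N - c 7%N by rewrite -def_b; ring.
apply/dvdzP; exists ((a ^+ 2 - b ^+ 2)
  * ((a - c 2%N - c 6%N) ^+ 2 + (b - c 3%N - c 7%N) ^+ 2)
  * ((2 * (a - c 2%N - c 4%N) * (a - c 4%N - c 6%N)
       + (c 1%N - c 5%N) * (c 3%N - c 7%N)) ^+ 2
   + (2 * (b - c 3%N - c 5%N) * (b - c 5%N - c 7%N)
       - (c 0%N - c 4%N) * (c 2%N - c 6%N)) ^+ 2)).
by unfold_det8; rewrite c0 c1; ring.
Qed.

Lemma odd_values (c : nat -> int) (a b : int) :
  c 0%N + c 2%N + c 4%N + c 6%N = 2 * a + 1 ->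
  c 1%N + c 3%N + c 5%N + c 7%N = 2 * b + 1 ->
  exists r s t u, [/\ gre c = 2 * r + 1, gim c = 2 * s + 1, Fz_re c = 2 * t + 1
     & Fz_im c = 2 * u + 1].
Proof.
move=> def_a def_b.
have c0 : c 0%N = 2 * a + 1 - c 2%N - c 4%N - c 6%N by rewrite -def_a; ring.
have c1 : c 1%N = 2 * b + 1 - c 3%N - c 5%N - c 7%N by rewrite -def_b; ring.
exists (a - c 2%N - c 6%N), (b - c 3%N - c 7%N).
pose d1 := c 1%N - c 5%N; pose d3 := c 3%N - c 7%N.
pose d0 := c 0%N - c 4%N; pose d2 := c 2%N - c 6%N.
pose g := a - c 4%N - c 2%N; pose h := b - c 5%N - c 3%N.
exists (2 * g ^+ 2 + 2 * g + 2 * d2 * g + d2 + d1 * d3).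
exists (2 * h ^+ 2 + 2 * h + 2 * d3 * h + d3 - d0 * d2).
unfold_det8; rewrite /d0 /d1 /d2 /d3 /g /h c0 c1.
split; ring.
Qed.

(** Only the parity of this sum matters: it is determined by [c] modulo 2, hence the
same for both vectors. *)
Definition corr4 (c : nat -> int) : int :=
  c 0%N * c 4%N + c 1%N * c 5%N + c 2%N * c 6%N + c 3%N * c 7%N.

(** Exactly one of e0, e2 and one of e1, e3 is odd. The condition on [Fz_re] relates
one half of each even one among the [e i] to the corresponding entries of [c],
which is how a quantity modulo 4 becomes determined by [c] modulo 2. *)
Lemma corr4_mod4 (c : nat -> int) (a b j : int) :
  let e i := c i + c i.+4 in
  e 0%N + e 2%N = 2 * a + 1 -> e 1%N + e 3%N = 2 * b + 1 ->
  Fz_re c = 8 * j + 1 \/ Fz_re c = 8 * j - 1 ->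
  exists k, e 0%N * e 2%N - e 1%N * e 3%N = 4 * k + 2 * corr4 c.
Proof.
rewrite /corr4 /Fz_re /relre.
move: (c 0%N) (c 1%N) (c 2%N) (c 3%N) (c 4%N) (c 5%N) (c 6%N) (c 7%N).
move=> c0 c1 c2 c3 c4 c5 c6 c7 /= odd02 odd13 def_j.
have [t4 p4] := pronic_even c4; have [t5 p5] := pronic_even c5.
have [t6 p6] := pronic_even c6; have [t7 p7] := pronic_even c7.
suff: (4 %| (c0 + c4) * (c2 + c6) - (c1 + c5) * (c3 + c7)
  - 2 * (c0 * c4 + c1 * c5 + c2 * c6 + c3 * c7))%Z.
  by case/dvdzP=> k def_k; exists k; clear - def_k; lia.
(* One of the two sums is even and the other is odd. *)
have split_odd (u v u' v' n : int) : u + u' + (v + v') = 2 * n + 1 ->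
    exists x y, u = 2 * x - u' /\ v = 2 * y + 1 - v'
             \/ u = 2 * x + 1 - u' /\ v = 2 * y - v'.
  by have [x parity_u] := parity (u + u') => odd_uv; exists x, (n - x); lia.
have [x [y cases02]] := split_odd _ _ _ _ _ odd02.
have [z [w cases13]] := split_odd _ _ _ _ _ odd13.
have [t def_t] := pronic_even (x - c4); have [s def_s] := pronic_even (y - c6).
clear odd02 odd13 split_odd.
case: cases02 cases13 => -[def_c0 def_c2] [] [def_c1 def_c3]; subst c0 c1 c2 c3; lia.
Qed.

(** F(1) F(-1) = (e0 + e2)^2 - (e1 + e3)^2 differs from gre^2 - gim^2 by
4 (e0 e2 - e1 e3), and an odd number that is 1 or -1 modulo 8 has a square that
is 1 modulo 16. *)
Lemma sum_alt_corr4 (c : nat -> int) (a b : int) :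
  c 0%N + c 2%N + c 4%N + c 6%N = 2 * a + 1 ->
  c 1%N + c 3%N + c 5%N + c 7%N = 2 * b + 1 ->
  ~ pm3 (gre c) -> ~ pm3 (gim c) -> ~ pm3 (Fz_re c) ->
  exists k, sum8 c * alt8 c = 8 * (2 * k + corr4 c).
Proof.
move=> def_a def_b.
have [r [s [t [u [def_r def_s def_t _]]]]] := odd_values def_a def_b.
rewrite def_r def_s => /not_pm3_sqr[k def_k] /not_pm3_sqr[l def_l].
rewrite def_t => /not_pm3[j def_j]; rewrite -def_t in def_j.
have [||m def_m] := @corr4_mod4 c a b j _ _ def_j.
- by rewrite -def_a; ring.
- by rewrite -def_b; ring.
exists (k - l + m).
have -> : sum8 c * alt8 c = gre c ^+ 2 - gim c ^+ 2 + 4 * (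
   (c 0%N + c 4%N) * (c 2%N + c 6%N) - (c 1%N + c 5%N) * (c 3%N + c 7%N)).
  by unfold_det8; ring.
by rewrite def_r def_s def_k def_l def_m; ring.
Qed.

(** The alternative is what makes 2^11 special: without an exceptional divisor, the
parity of [u] is known from [c] modulo 2. *)
Lemma det8_even_shape (c : nat -> int) (a b : int) :
  c 0%N + c 2%N + c 4%N + c 6%N = 2 * a + 1 ->
  c 1%N + c 3%N + c 5%N + c 7%N = 2 * b + 1 ->
  exists u v : int, [/\ det8 c = 32 * u * (2 * v + 1)
    & (exists k, u = 2 * k + corr4 c)
      \/ exists2 e, exceptional e & (e %| 2 * v + 1)%Z].
Proof.
move=> def_a def_b.
have [u def_u] : exists u, sum8 c * alt8 c = 8 * u.
  have [t def_t] := pronic_even a; have [w def_w] := pronic_even b.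
  have -> : sum8 c * alt8 c = 4 * (a * a + a) - 4 * (b * b + b).
    transitivity ((2 * a + 1) ^+ 2 - (2 * b + 1) ^+ 2); last by ring.
    by rewrite -def_a -def_b; unfold_det8; ring.
  by exists (t - w); rewrite def_t def_w; ring.
have [r [s [t [w [def_r def_s def_t def_w]]]]] := odd_values def_a def_b.
pose V := r ^+ 2 + r + s ^+ 2 + s; pose W := t ^+ 2 + t + w ^+ 2 + w.
exists u, (2 * V * W + V + W).
have -> : 2 * (2 * V * W + V + W) + 1 = (2 * V + 1) * (2 * W + 1) by ring.
split.
  rewrite (_ : det8 c = sum8 c * alt8 c * (gre c ^+ 2 + gim c ^+ 2)
    * (Fz_re c ^+ 2 + Fz_im c ^+ 2)) // def_u def_r def_s def_t def_w /V /W; ring.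
have [bad_r|ok_r] := pm3_dec (2 * r + 1).
  have [|e exc dvd_e] := @exceptional_half_norm r s; first by left.
  by right; exists e; rewrite // dvdz_mulr.
have [bad_s|ok_s] := pm3_dec (2 * s + 1).
  have [|e exc dvd_e] := @exceptional_half_norm r s; first by right.
  by right; exists e; rewrite // dvdz_mulr.
have [bad_t|ok_t] := pm3_dec (2 * t + 1).
  have [|e exc dvd_e] := @exceptional_half_norm t w; first by left.
  by right; exists e; rewrite // dvdz_mull.
left; have [|||k] := sum_alt_corr4 def_a def_b; rewrite ?def_r ?def_s ?def_t //.
by rewrite def_u => def_k; exists k; clear - def_k; lia.
Qed.

(** The product is 2^10 u w P with P odd. If u w is 2 modulo 4, then u and w have
different parities, so at least one factor has an exceptional divisor. *)
Lemma even_group_det (x y : nat -> int) (n : int) :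
  n = det8 (fun i => x i + y i) * det8 (fun i => x i - y i) ->
  (2 %| sum8 x + sum8 y)%Z ->
  [\/ exists m, n = 2 ^+ 10 * (2 * m + 1), exists m, n = 2 ^+ 12 * m
    | exists e m, exceptional e /\ n = 2 ^+ 11 * e * (2 * m + 1)].
Proof.
move=> def_n even_sum.
set cp := fun i => _ in def_n; set cm := fun i => x i - y i in def_n.
have par (i : nat -> nat) : exists k,
   cm (i 0%N) + cm (i 1%N) + cm (i 2%N) + cm (i 3%N)
   = cp (i 0%N) + cp (i 1%N) + cp (i 2%N) + cp (i 3%N) + 2 * k.
  exists (- (y (i 0%N) + y (i 1%N) + y (i 2%N) + y (i 3%N))); rewrite /cm /cp; ring.
have [k0 /= def_k0] := par (nth 0 [:: 0; 2; 4; 6])%N.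
have [k1 /= def_k1] := par (nth 0 [:: 1; 3; 5; 7])%N.
have [a even_a] := parity (cp 0%N + cp 2%N + cp 4%N + cp 6%N).
have [b even_b] := parity (cp 1%N + cp 3%N + cp 5%N + cp 7%N).
have sum_cp : sum8 x + sum8 y = cp 0%N + cp 2%N + cp 4%N + cp 6%N
   + (cp 1%N + cp 3%N + cp 5%N + cp 7%N) by rewrite /cp /sum8; ring.
case: even_a => def_a; case: even_b => def_b.
- constructor 2.
  have /dvdzP[u def_u] := det8_dvd64 def_a def_b.
  have /dvdzP[v def_v] : (64 %| det8 cm)%Z.
    apply: (@det8_dvd64 _ (a + k0) (b + k1)).
      by rewrite def_k0 def_a; ring.
    by rewrite def_k1 def_b; ring.
  by exists (u * v); rewrite def_n def_u def_v; ring.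
- by move: even_sum; rewrite sum_cp def_a def_b; clear; lia.
- by move: even_sum; rewrite sum_cp def_a def_b; clear; lia.
have [u [v [def_u exc_u]]] := det8_even_shape def_a def_b.
have [||w [z [def_w exc_w]]] := @det8_even_shape cm (a + k0) (b + k1).
- by rewrite def_k0 def_a; ring.
- by rewrite def_k1 def_b; ring.
pose P := 2 * (2 * v * z + v + z) + 1.
have {}def_n : n = 2 ^+ 10 * (u * w) * P by rewrite def_n def_u def_w /P; ring.
have [m [def_m|def_m]] := parity (u * w).
  have [l [def_l|def_l]] := parity m.
    constructor 2; exists (l * P); rewrite def_n def_m def_l; ring.
  constructor 3.
  have [e exc_e /dvdzP[F def_F]] : exists2 e, exceptional e & (e %| P)%Z.
    have -> : P = (2 * v + 1) * (2 * z + 1) by rewrite /P; ring.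
    case: exc_u => [[k def_k]|[e exc_e dvd_e]]; last first.
      by exists e => //; apply: dvdz_mulr.
    case: exc_w => [[j def_j]|[e exc_e dvd_e]]; last first.
      by exists e => //; apply: dvdz_mull.
    (* Otherwise u = w modulo 2, so u w cannot be 2 modulo 4. *)
    have [i def_i] : exists i, corr4 cm = corr4 cp + 2 * i.
      exists (- (y 0%N * x 4%N + x 0%N * y 4%N + y 1%N * x 5%N + x 1%N * y 5%N
        + y 2%N * x 6%N + x 2%N * y 6%N + y 3%N * x 7%N + x 3%N * y 7%N)).
      by rewrite /corr4 /cp /cm; ring.
    exfalso; move: def_m; rewrite def_l def_k def_j def_i; clear.
    by have [h [->|->]] := parity (corr4 cp); lia.
  have [f [def_f|def_f]] := parity F.
    exfalso; move: def_F; rewrite /P def_f; clear; lia.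
  exists e, (2 * l * f + l + f); split=> //.
  by rewrite def_n def_m def_l def_F def_f; ring.
constructor 1; exists (2 * m * (2 * v * z + v + z) + m + (2 * v * z + v + z)).
by rewrite def_n def_m /P; ring.
Qed.

Lemma group_dets_cases (n : int) : group_dets C8xC2 n ->
  [\/ (exists m, n = 16 * m + 1) \/ setA n,
      exists m, n = 2 ^+ 10 * (2 * m + 1), exists m, n = 2 ^+ 12 * m
    | exists e m, exceptional e /\ n = 2 ^+ 11 * e * (2 * m + 1)].
Proof.
case=> z _ <-; rewrite group_det_C8xC2.
set x := fun i => z (inord i, 0); set y := fun i => z (inord i, 1).
have [even_sum|odd_sum] := boolP (2 %| sum8 x + sum8 y)%Z; last first.
  by constructor 1; apply: odd_group_det odd_sum.
case: (even_group_det erefl even_sum);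
  by [constructor 2 | constructor 3 | constructor 4].
Qed.

(** * Realization *)

(** The two polynomials attached to a function on the group are arbitrary up to
congruence modulo 2. *)
Lemma det8_pair_in_dets (c y : nat -> int) :
  group_dets C8xC2 (det8 (fun i => c i + 2 * y i) * det8 c).
Proof.
exists (fun u : 'Z_8 * 'Z_2 => if u.2 == 0 then c u.1 + y u.1 else y u.1) => //.
rewrite group_det_C8xC2; congr (_ * _); apply: eq_det8 => i lti8 /=.
  by rewrite inordK //; ring.
by rewrite inordK //; ring.
Qed.

(** [realize c y] uses the polynomials with coefficients [c + 2 y] and [c]. *)
Ltac realize c y := have := det8_pair_in_dets (nth 0 c) (nth 0 y);
  unfold_det8; rewrite /=; congr (group_dets _ _).

(** Adding the constant vector 2 m changes only the value at 1, by 16 m. *)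
Lemma one_mod16_in_dets (m : int) : group_dets C8xC2 (16 * m + 1).
Proof.
by realize [:: 1; 0; 0; 0; 0; 0; 0; 0 : int] (nseq 8 m); ring.
Qed.

(** The polynomials - x^4 - x^5 - x^6 shifted by the constant vectors k and l take
the values 8 k - 3 and 8 l - 3 at 1, and units elsewhere. *)
Lemma setA_in_dets (n : int) : setA n -> group_dets C8xC2 n.
Proof.
case=> k [l [eq_kl ->]].
have [y ->] : exists y, k = l + 2 * y by exists ((k - l) %/ 2)%Z; clear - eq_kl; lia.
by realize [:: l; l; l; l; l - 1; l - 1; l - 1; l] (nseq 8 y); ring.
Qed.

(** The value at 1 of one polynomial runs through 4 + 16 s; two choices of the
other values, with products of opposite sign, cover both classes modulo 4. *)
Lemma pow10_in_dets (m : int) : group_dets C8xC2 (2 ^+ 10 * (2 * m + 1)).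
Proof.
have [s [->|->]] := parity m.
  by realize [:: 0; 0; -1; 0; -1; -1; -1; 0 : int]
    [:: s; s; s + 1; s; s + 1; s + 1; s + 1; s]; ring.
by realize [:: 0; 0; -1; 0; -1; -1; -1; 0 : int]
    [:: - s - 1; - s - 1; - s; - s - 1; - s; - s; - s - 1; - s]; ring.
Qed.

Lemma pow12_in_dets (m : int) : group_dets C8xC2 (2 ^+ 12 * m).
Proof.
have [s [->|->]] := parity m.
  by realize [:: 2; 2; 0; 0; 0; 1; 1; 2 : int]
    [:: - s - 1; - s - 1; - s; - s; - s; - s - 1; - s; - s - 1]; ring.
by realize [:: 2; 2; 0; 0; 0; 1; 1; 2 : int] (nseq 8 s); ring.
Qed.

(** The first polynomial has value (8 k - 1) + (8 l + 3) i at i and 8 (2 s + 1) at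
1; all other factors of the two determinants are powers of 2 up to sign. *)
Lemma pow11_gauss_in_dets (k l s : int) :
  group_dets C8xC2 (2 ^+ 10 * ((8 * k - 1) ^+ 2 + (8 * l + 3) ^+ 2) * (2 * s + 1)).
Proof.
by realize [:: 0; -1; 0; 0; -1; -1; 0; -1 : int]
  [:: s + k; s + l + 1; s - k; s - l;
      s + k + 1; s + l + 2; s - k + 1; s - l + 1]; ring.
Qed.

(** One polynomial takes the value (1 + z) h at z, where h has the coordinates given
to [norm8], and the other takes the value 8 (2 m + 1) at 1 up to sign. Their
congruence modulo 2 depends on the parity of C, hence the two cases. *)
Lemma pow11_norm8_in_dets (A B C D m : int) :
  group_dets C8xC2
    (2 ^+ 11 * norm8 (4 * A + 1) (4 * B + 2) (2 * C) (4 * D) * (2 * m + 1)).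
Proof.
have [E [->|->]] := parity C.
  by realize [:: -2 - 2 * m; - 2 * m; - 2 * m; - 2 * m;
       -1 - 2 * m; -1 - 2 * m; -2 - 2 * m; -2 - 2 * m]
   [:: A - D + 1 + m; A + B + 1 + m; B + E + m; E + D + m;
       D - A + m; m - A - B; m - B - E; 1 + m - E - D]; ring.
set t := 2 * (m + 1).
by realize [:: t - 2; t; t; t; t - 1; t - 1; t - 2; t - 2]
   [:: A - D - m; A + B - m; B + E - m; E + D - m;
       D - A - m - 1; - m - A - B - 1; - B - E - m - 1; - m - E - D];
  rewrite /t; ring.
Qed.

Definition in_dets11 (n : int) :=
  forall m, group_dets C8xC2 (2 ^+ 11 * n * (2 * m + 1)).

(** The field automorphism z -> z^3 sends the coordinates to (d0, d3, - d2, d1);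
together with h -> - h it leads to the shape of [pow11_norm8_in_dets]. *)
Lemma norm8_in_dets_even (d0 d1 d2 d3 : int) : ~~ (2 %| d0)%Z -> (2 %| d2)%Z ->
  (2 %| d1)%Z -> ~~ (4 %| d1 + d3)%Z -> (2 %| d3)%Z -> in_dets11 (norm8 d0 d1 d2 d3).
Proof.
wlog d1_2 : d1 d2 d3 / (4 %| d3)%Z.
  move=> IH odd0 even2 even1 odd13 even3.
  have [d3_4|d3_2] := boolP (4 %| d3)%Z; first exact: IH.
  have -> : norm8 d0 d1 d2 d3 = norm8 d0 d3 (- d2) d1.
    by rewrite /norm8 /relre /relim; ring.
  by apply: IH => //; lia.
move=> odd0 even2 even1 odd13 _ m.
wlog d0_1 : d0 d1 d2 d3 d1_2 odd0 even2 even1 odd13 / (d0 = 1 %[mod 4])%Z.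
  have [d0_1|d0_3] := eqVneq (d0 %% 4)%Z 1; first by apply.
  have -> : norm8 d0 d1 d2 d3 = norm8 (- d0) (- d1) (- d2) (- d3).
    by rewrite /norm8 /relre /relim; ring.
  by apply; clear - d1_2 odd0 even2 even1 odd13 d0_3; lia.
have [A ->] : exists A, d0 = 4 * A + 1 by exists (d0 %/ 4)%Z; clear - d0_1; lia.
have [B ->] : exists B, d1 = 4 * B + 2.
  by exists (d1 %/ 4)%Z; clear - even1 odd13 d1_2; lia.
have [C ->] : exists C, d2 = 2 * C by exists (d2 %/ 2)%Z; clear - even2; lia.
have [D ->] : exists D, d3 = 4 * D by exists (d3 %/ 4)%Z; clear - d1_2; lia.
exact: pow11_norm8_in_dets.
Qed.

(** The condition on the relative norm means d1 + d3 = 2 modulo 4. If d1 and d3 are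
odd, multiplication by the unit 1 + z - z^3 makes them even. *)
Lemma norm8_in_dets_odd0 (d0 d1 d2 d3 : int) : ~~ (2 %| d0)%Z -> (2 %| d2)%Z ->
  (2 %| d1 + d3)%Z -> pm3 (relre d0 d1 d2 d3 + relim d0 d1 d2 d3) ->
  in_dets11 (norm8 d0 d1 d2 d3).
Proof.
move=> odd0 even2 even13 bad.
have odd13 : ~~ (4 %| d1 + d3)%Z.
  apply/negP=> /dvdzP[s def_s].
  move: bad; have -> : d1 = s * 4 - d3 by rewrite -def_s; ring.
  have [C ->] : exists C, d2 = 2 * C by exists (d2 %/ 2)%Z; clear - even2; lia.
  have [A ->] : exists A, d0 = 2 * A + 1 by exists (d0 %/ 2)%Z; clear - odd0; lia.
  have [t def_t] := pronic_even A; have [w def_w] := pronic_even C.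
  rewrite /pm3 /relre /relim; have [E [->|->]] := parity d3; clear - def_t def_w; lia.
have [even1|odd1] := boolP (2 %| d1)%Z.
  by apply: norm8_in_dets_even => //; clear - even1 even13; lia.
have -> : norm8 d0 d1 d2 d3
    = norm8 (d0 + d1 - d3) (d0 + d1 + d2) (d1 + d2 + d3) (d2 + d3 - d0).
  by rewrite /norm8 /relre /relim; ring.
by apply: norm8_in_dets_even; clear - odd0 even2 even13 odd13 odd1; lia.
Qed.

(** Multiplication by z and by z^2 moves the odd coordinates to the required
positions, and changes the relative norm by a unit of the Gaussian integers. *)
Lemma norm8_in_dets (d0 d1 d2 d3 : int) : ~~ (2 %| norm8 d0 d1 d2 d3)%Z ->
  pm3 (relre d0 d1 d2 d3 + relim d0 d1 d2 d3) -> in_dets11 (norm8 d0 d1 d2 d3).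
Proof.
move=> odd_norm; have odd_sum : ~~ (2 %| d0 + d1 + d2 + d3)%Z.
  have [n def_n] := norm8_parity d0 d1 d2 d3.
  by rewrite def_n in odd_norm; clear - odd_norm; lia.
move: odd_norm odd_sum.
wlog odd02 : d0 d1 d2 d3 / ~~ (2 %| d0 + d2)%Z.
  move=> IH odd_norm odd_sum bad.
  have [even02|odd02] := boolP (2 %| d0 + d2)%Z; last exact: IH.
  have rotE : norm8 (- d3) d0 d1 d2 = norm8 d0 d1 d2 d3.
    by rewrite /norm8 /relre /relim; ring.
  rewrite -rotE; apply: IH; rewrite ?rotE //.
  - by clear - odd_sum even02; lia.
  - by clear - odd_sum; lia.
  - apply: pm3_add8 (pm3N bad).
    rewrite (_ : _ - _ = 2 * relre d0 d1 d2 d3); last by rewrite /relre /relim; ring.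
    have [x def_x] : exists x, d0 = 2 * x - d2.
      by exists ((d0 + d2) %/ 2)%Z; clear - even02; lia.
    have [y def_y] : exists y, d1 = 2 * y + 1 - d3.
      by exists ((d1 + d3) %/ 2)%Z; clear - odd_sum even02; lia.
    have [t def_t] := pronic_even d3.
    by rewrite /relre def_x def_y; clear - def_t; lia.
wlog odd0 : d0 d1 d2 d3 odd02 / ~~ (2 %| d0)%Z.
  move=> IH odd_norm odd_sum bad.
  have [even0|odd0] := boolP (2 %| d0)%Z; last exact: IH.
  have rotE : norm8 (- d2) (- d3) d0 d1 = norm8 d0 d1 d2 d3.
    by rewrite /norm8 /relre /relim; ring.
  rewrite -rotE; apply: IH; rewrite ?rotE //.
  - by clear - odd02; lia.
  - by clear - even0 odd02; lia.
  - by clear - odd_sum; lia.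
  - rewrite (_ : _ + _ = - (relre d0 d1 d2 d3 + relim d0 d1 d2 d3)).
      exact: pm3N.
    by rewrite /relre /relim; ring.
move=> _ odd_sum; apply: norm8_in_dets_odd0 => //.
  by clear - odd0 odd02; lia.
by clear - odd_sum odd02; lia.
Qed.

Lemma split_prime_in_dets p (a b : int) : prime p -> (p %% 8 = 1)%N ->
  p%:Z = a ^+ 2 + b ^+ 2 -> pm3 (a + b) -> in_dets11 p%:Z.
Proof.
move=> p_pr p1 def_p bad; have [d0 [d1 [d2 [d3 def_d]]]] := prime_is_norm8 p_pr p1.
rewrite -def_d; apply: norm8_in_dets; first by rewrite def_d; clear - p1; lia.
by apply: pm3_two_squares p_pr p1 def_p _ bad; rewrite -def_d.
Qed.

(** p = x^2 + 2 y^2 is the relative norm of x + y (z + z^3), hence p^2 its norm. *)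
Lemma inert3_sqr_in_dets p : prime p -> (p %% 8 = 3)%N -> in_dets11 (p%:Z ^+ 2).
Proof.
move=> p_pr p3; have [x [y def_p]] := square_plus_two_squares p_pr p3.
have def_re : relre x y 0 y = p%:Z by rewrite /relre def_p; ring.
have def_im : relim x y 0 y = 0 by rewrite /relim; ring.
have -> : p%:Z ^+ 2 = norm8 x y 0 y by rewrite /norm8 def_re def_im; ring.
apply: norm8_in_dets; rewrite /norm8 def_re def_im ?addr0.
  by have [h [E|E]] := parity p%:Z; rewrite E; [clear - p3 E|clear]; lia.
by rewrite /pm3; clear - p3; lia.
Qed.

(** One of the eight associates and conjugates of (1 + i)(a + b i) has parts that
are -1 and 3 modulo 8. *)
Lemma five_mod8_in_dets p : prime p -> (p %% 8 = 5)%N -> in_dets11 p%:Z.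
Proof.
move=> p_pr p5 m; have [|a [b]] := two_squares p_pr; first by clear - p5; lia.
wlog odd_a : a b / ~~ (2 %| a)%Z => [IH def_p|].
  have [even_a|] := boolP (2 %| a)%Z; last by move=> odd_a; apply: (IH a b).
  apply: (IH b a); last by rewrite addrC.
  move: def_p p5; have [h ->] : exists h, a = 2 * h.
    by exists (a %/ 2)%Z; clear - even_a; lia.
  have [h' [->|->]] := parity b; clear; lia.
move=> def_p.
have [b' def_b] : exists b', b = 4 * b' + 2.
  have [x def_x] : exists x, a = 2 * x + 1 by exists (a %/ 2)%Z; clear - odd_a; lia.
  move: def_p p5; rewrite def_x; have [t def_t] := pronic_even x.
  have [y [->|->]] := parity b; last by clear; lia.
  have [z [->|->]] := parity y; first by clear - def_t; lia.
  by move=> _ _; exists z; ring.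
suff [k [l def_kl]] : exists k l, (8 * k - 1) ^+ 2 + (8 * l + 3) ^+ 2 = 2 * p%:Z.
  by have := pow11_gauss_in_dets k l m; rewrite def_kl; congr (group_dets _ _); ring.
(* a - b and a + b are odd and differ by 4 modulo 8. *)
have sum2 : (a - b) ^+ 2 + (a + b) ^+ 2 = 2 * p%:Z by rewrite def_p; ring.
have witness (u v : int) : u ^+ 2 + v ^+ 2 = 2 * p%:Z ->
    (u = - 1 %[mod 8])%Z -> (v = 3 %[mod 8])%Z ->
    exists k l, (8 * k - 1) ^+ 2 + (8 * l + 3) ^+ 2 = 2 * p%:Z.
  move=> <- u7 v3; exists ((u + 1) %/ 8)%Z, (v %/ 8)%Z.
  by congr (_ ^+ 2 + _ ^+ 2); clear - u7 v3; lia.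
have cases : [|| (a + b == 3 %[mod 8])%Z, (a + b == -3 %[mod 8])%Z,
                 (a + b == -1 %[mod 8])%Z | (a + b == 1 %[mod 8])%Z].
  by rewrite def_b; clear - odd_a; lia.
case/or4P: cases => /eqP mod_ab.
- by apply: (witness (a - b) (a + b)) => //; clear - mod_ab def_b; lia.
- apply: (witness (b - a) (- (a + b))); [by rewrite -sum2; ring | |];
    by clear - mod_ab def_b; lia.
- apply: (witness (a + b) (a - b)); [by rewrite -sum2; ring | |];
    by clear - mod_ab def_b; lia.
- apply: (witness (- (a + b)) (b - a)); [by rewrite -sum2; ring | |];
    by clear - mod_ab def_b; lia.
Qed.

Lemma exceptional_in_dets (e : int) : exceptional e -> in_dets11 e.
Proof.
case=> [p a b p_pr def_p p1 bad ->|p p_pr p5 ->|p p_pr p3 ->].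
- by apply: split_prime_in_dets def_p bad => //; clear - p1; lia.
- by apply: five_mod8_in_dets => //; clear - p5; lia.
- by apply: inert3_sqr_in_dets => //; clear - p3; lia.
Qed.

(** * The integer group determinants of C8 x C2 *)

(** A number that is 5 modulo 8 is at least 3 in absolute value, and 3 * 3 > 7. *)
Lemma neg7_notin_setA : ~ setA (- 7).
Proof.
case=> k [l [_]].
have bound (h : int) : 5 <= 8 * h - 3 \/ 8 * h - 3 <= - 3 by lia.
move: (8 * k - 3) (8 * l - 3) (bound k) (bound l) => u v [Hu|Hu] [Hv|Hv];
  clear - Hu Hv; nia.
Qed.

Local Open Scope classical_set_scope.
Local Open Scope ring_scope.

Theorem theorem1p5 :
  setA `<` [set n : int | exists m : int, n = 16 * m - 7] /\
  group_dets C8xC2 =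
    [set n : int | exists m : int, n = 16 * m + 1]
    `|` setA
    `|` [set n : int | exists m : int, n = 2 ^+ 10 * (2 * m + 1)]
    `|` [set n : int | exists m : int, n = 2 ^+ 12 * m]
    `|` [set n : int | exists (p : nat) (a b m : int),
           [/\ prime p,
               p%:Z = a ^+ 2 + b ^+ 2,
               (p%:Z = 1 %[mod 8])%Z,
               (a + b = 3 %[mod 8])%Z \/ (a + b = - 3 %[mod 8])%Z &
               n = 2 ^+ 11 * p%:Z * (2 * m + 1)]]
    `|` [set n : int | exists (p : nat) (m : int),
           [/\ prime p,
               (p%:Z = - 3 %[mod 8])%Z &
               n = 2 ^+ 11 * p%:Z * (2 * m + 1)]]
    `|` [set n : int | exists (p : nat) (m : int),
           [/\ prime p,
               (p%:Z = 3 %[mod 8])%Z &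
               n = 2 ^+ 11 * p%:Z ^+ 2 * (2 * m + 1)]].
Proof.
split.
  split=> [n [k [l [eq_kl ->]]] | sub].
    have [h ->] : exists h, k = l + 2 * h.
      by exists ((k - l) %/ 2)%Z; clear - eq_kl; lia.
    by exists (4 * l ^+ 2 + 8 * h * l - 3 * l - 3 * h + 1); ring.
  by apply: neg7_notin_setA; apply: sub; exists 0.
apply/seteqP; split=> n /=.
  case/group_dets_cases=> [[odd_n|A_n]|n10|n12|[e [m [exc_e def_n]]]].
  - by do 6 left.
  - by do 5 left; right.
  - by do 4 left; right.
  - by do 3 left; right.
  - case: exc_e def_n => [p a b p_pr def_p p1 bad ->|p p_pr p5 ->|p p_pr p3 ->] def_n.
    + by do 2 left; right; exists p, a, b, m.
    + by left; right; exists p, m.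
    + by right; exists p, m.
case=> [[[[[[[m ->]|A_n]|[m ->]]|[m ->]]|[p [a [b [m]]]]]|[p [m]]]|[p [m]]];
  try case=> p_pr.
- exact: one_mod16_in_dets.
- exact: setA_in_dets.
- exact: pow10_in_dets.
- exact: pow12_in_dets.
- by move=> def_p p1 bad ->; apply/exceptional_in_dets/(ExcSplit p_pr def_p p1 bad).
- by move=> p5 ->; apply/exceptional_in_dets/(ExcInert5 p_pr p5).
- by move=> p3 ->; apply/exceptional_in_dets/(ExcInert3 p_pr p3).
Qed.
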